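(* Let $n\ge1$. The map $$\big(\mathrm{vlk}^{\mathrm{mod}}_{ij}+\mathrm{vlk}^{\mathrm{mod}}_{ji}\big)_{1\le i<j\le n}\oplus\big(\mathrm{vlk}^{\mathrm{mod}}_{i*}\big)_{1\le i\le n-1}$$ with values in $\mathbb{Z}_2^{\frac{n(n-1)}{2}}\oplus\mathbb{Z}_2^{n-1}=\mathbb{Z}_2^{\frac{(n+2)(n-1)}{2}}$ w-classifies $\mathrm{wBP}$; that is, it is invariant under welded Reidemeister moves and under $\mathrm{wBP}$, and the induced map $\mathrm{wSL}_n^{\mathrm{wBP}}\to\mathbb{Z}_2^{\frac{(n+2)(n-1)}{2}}$ is an isomorphism of monoids.
   Context: A Gauss diagram on $n$ strands is a finite set of signed arrows (tail, head, sign $\pm1$), all endpoints being distinct points of $n$ ordered oriented intervals (strands), up to orientation-preserving homeomorphisms of the intervals; Gauss diagrams form a monoid under stacking (concatenation of corresponding strands). Endpoints are adjacent if they lie on the same strand with no other endpoint between them. Moves are used in both directions; portions of strands below are disjoint, contain only the mentioned endpoints, and may lie on any strands with any orientation. Welded Reidemeister moves: (R1) insert or delete an arrow of any sign with adjacent endpoints; (R2) insert or delete two arrows with opposite signs whose tails are adjacent on one portion and whose heads are adjacent on another; (R3) given portions $s_1,s_2,s_3$ containing exactly the endpoints of arrows $s_1\to s_2$, $s_2\to s_3$, $s_1\to s_3$ with signs $\varepsilon_{12},\varepsilon_{23},\varepsilon_{13}$, exchange the two endpoints on each portion, provided $\varepsilon_{12}\eta_1\eta_2=\varepsilon_{23}\eta_2\eta_3=-\varepsilon_{13}\eta_1\eta_3$,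 where $\eta_k=+1$ if along the orientation the endpoint on $s_k$ of the arrow joining $s_k$ and $s_{k-1}$ precedes that of the arrow joining $s_k$ and $s_{k+1}$ (indices mod 3), and $-1$ otherwise; (OC) exchange two adjacent tails. The monoid $\mathrm{wSL}_n$ of welded string links is the quotient of Gauss diagrams on $n$ strands by these moves (equivalently, virtual string link diagrams up to welded Reidemeister moves), and $\mathrm{wSL}_n^\mu$ is its quotient by a move $\mu$. $\mathrm{SR}$: change the sign of an arrow, keeping its direction. $\mathrm{BP}$ (unoriented band-pass): given portions $s_1,\dots,s_4$ containing exactly the endpoints of four arrows, one from $s_i$ to $s_j$ with sign $\varepsilon_{ij}$ for each $i\in\{1,2\}$, $j\in\{3,4\}$, reverse direction and change sign of all four, provided $\varepsilon_{ij}\eta_i\eta_j$ is the same for all four pairs, where $\eta_i=+1$ ($i\in\{1,2\}$) if along the orientation the endpoint on $s_i$ of the arrow to $s_3$ precedes that of the arrow to $s_4$, $\eta_j=+1$ ($j\in\{3,4\}$) if the endpoint on $s_j$ of the arrow from $s_1$ precedes that of the arrow from $s_2$, and $-1$ otherwise. $\mathrm{wBP}$ (welded band-pass): a $\mathrm{BP}$ move followed by an $\mathrm{SR}$ move on one of the four arrows involved. For $i\neq j$, $\mathrm{vlk}_{ij}$ is the sum of the signs of all arrows with tail on strand $i$ and head on strand $j$; $\mathrm{vlk}_{ij}^{\mathrm{mod}}$ is its reduction modulo 2, and $\mathrm{vlk}_{i*}^{\mathrm{mod}}$ is the reduction modulo 2 of $\sum_{k\neq i}\mathrm{vlk}_{ik}$.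 *)

(* Defs.v *)
From Stdlib Require Import Relation_Operators.
From HB Require Import structures.
From mathcomp Require Import all_boot all_order all_fingroup all_algebra.
From mathcomp Require Import boolp.

Set Implicit Arguments.
Unset Strict Implicit.
Unset Printing Implicit Defensive.

Import GRing.Theory.
Local Open Scope quotient_scope.

(* An endpoint is an arrow together with a side; signs are booleans as well,
   [true] standing for +1. *)
Notation tail := false (only parsing).
Notation head := true (only parsing).
Definition sg (b : bool) : int := (if b then 1 else -1)%R.

(* The strand i is the word of the endpoints met when travelling along it.  The
   homeomorphism classes of Gauss diagrams are the classes of these words up to
   renaming of the arrows, see [diagram_iso] below. *)
Record gauss (n : nat) := Gauss {
  narr : nat;
  sgn : {ffun 'I_narr -> bool};
  strand : {ffun 'I_n -> seq ('I_narr * bool)};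
  _ : [forall e : 'I_narr * bool, \sum_(i < n) count_mem e (strand i) == 1]
}.

Notation arrow D := 'I_(narr D).
Notation endpoint D := ('I_(narr D) * bool)%type.

HB.instance Definition _ n := gen_eqMixin (gauss n).
HB.instance Definition _ n := gen_choiceMixin (gauss n).

Lemma gauss_once n (D : gauss n) (e : endpoint D) :
  \sum_(i < n) count_mem e (strand D i) = 1.
Proof. by case: D e => m s w ok e; apply/eqP; exact: (forallP ok). Qed.

Definition eps n (D : gauss n) (a : arrow D) : int := sg (sgn D a).

(* x and y are adjacent, x coming first exactly when b is true; thus the number
   eta attached to a portion with endpoints x and y is [sg b]. *)
Definition adjacent n (D : gauss n) (b : bool) (x y : endpoint D) : Prop :=
  exists i : 'I_n, infix (if b then [:: x; y] else [:: y; x]) (strand D i).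

Section Operations.
Variable n : nat.
Implicit Types D : gauss n.

Fact empty_gauss_subproof (w := [ffun=> [::]] : {ffun 'I_n -> seq ('I_0 * bool)}) :
  [forall e : 'I_0 * bool, \sum_(i < n) count_mem e (w i) == 1].
Proof. by apply/forallP => -[[]]. Qed.

Definition empty_gauss : gauss n :=
  Gauss [ffun=> true] empty_gauss_subproof.

Definition lend m1 m2 (e : 'I_m1 * bool) : 'I_(m1 + m2) * bool :=
  (lshift m2 e.1, e.2).
Definition rend m1 m2 (e : 'I_m2 * bool) : 'I_(m1 + m2) * bool :=
  (rshift m1 e.1, e.2).

Definition stack_sgn D1 D2 : {ffun 'I_(narr D1 + narr D2) -> bool} :=
  [ffun a => match split a with inl a1 => sgn D1 a1 | inr a2 => sgn D2 a2 end].

Definition stack_strand D1 D2 :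
    {ffun 'I_n -> seq ('I_(narr D1 + narr D2) * bool)} :=
  [ffun i => map (@lend (narr D1) (narr D2)) (strand D1 i)
             ++ map (@rend (narr D1) (narr D2)) (strand D2 i)].

Lemma lend_inj m1 m2 : injective (@lend m1 m2).
Proof. by move=> [a b] [c d] [] /val_inj -> ->. Qed.

Lemma rend_inj m1 m2 : injective (@rend m1 m2).
Proof. by move=> [a b] [c d] [] /addnI/val_inj -> ->. Qed.

Lemma lrend_neq m1 m2 (x : 'I_m1 * bool) (y : 'I_m2 * bool) :
  lend m2 x != rend m1 y.
Proof. by rewrite xpair_eqE eq_lrshift. Qed.

Lemma endP m1 m2 (e : 'I_(m1 + m2) * bool) :
  (exists x, e = lend m2 x) \/ (exists y, e = rend m1 y).
Proof.
by case: e => a b; case: (split_ordP a) => c ->; [left|right]; exists (c, b).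
Qed.

Fact stack_subproof D1 D2 : [forall e : 'I_(narr D1 + narr D2) * bool,
  \sum_(i < n) count_mem e (stack_strand D1 D2 i) == 1].
Proof.
apply/forallP => e; apply/eqP; case: (endP e) => -[x ->].
- rewrite -[RHS](gauss_once x); apply: eq_bigr => i _.
  rewrite ffunE count_cat !count_map [X in _ + X](eq_count (a2 := pred0)).
    by rewrite count_pred0 addn0; apply: eq_count => y /=; rewrite (inj_eq (@lend_inj _ _)).
  by move=> y /=; rewrite eq_sym (negPf (lrend_neq _ _)).
- rewrite -[RHS](gauss_once x); apply: eq_bigr => i _.
  rewrite ffunE count_cat !count_map [X in X + _](eq_count (a2 := pred0)).
    by rewrite count_pred0; apply: eq_count => y /=; rewrite (inj_eq (@rend_inj _ _)).
  by move=> y /=; rewrite (negPf (lrend_neq _ _)).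
Qed.

Definition stack D1 D2 : gauss n :=
  @Gauss n _ (stack_sgn D1 D2) _ (stack_subproof D1 D2).

(* Moving the endpoints of D by a permutation p: the place occupied by the
   endpoint e is taken over by p e. *)
Fact permute_ends_subproof D (p : {perm endpoint D})
    (w := [ffun i => map p (strand D i)] : {ffun 'I_n -> seq (endpoint D)}) :
  [forall e : endpoint D, \sum_(i < n) count_mem e (w i) == 1].
Proof.
apply/forallP => e; apply/eqP.
rewrite -[RHS](gauss_once ((p^-1)%g e)); apply: eq_bigr => i _.
rewrite ffunE count_map; apply: eq_count => y /=.
by rewrite -(inj_eq (@perm_inj _ p) y) permKV.
Qed.

Definition permute_ends D (p : {perm endpoint D}) : gauss n :=
  Gauss (sgn D) (permute_ends_subproof p).

Definition reverse_ends D (S : {set arrow D}) (e : endpoint D) : endpoint D :=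
  (e.1, (e.1 \in S) (+) e.2).

Lemma reverse_ends_inj D (S : {set arrow D}) : injective (reverse_ends S).
Proof. by move=> [a b] [c d] [] /= -> /addbI ->. Qed.

Definition reverse D (S : {set arrow D}) : gauss n :=
  permute_ends (perm (@reverse_ends_inj D S)).

Fact change_signs_subproof D :
  [forall e : endpoint D, \sum_(i < n) count_mem e (strand D i) == 1].
Proof. by case: D. Qed.

Definition change_signs D (S : {set arrow D}) : gauss n :=
  Gauss [ffun a => (a \in S) (+) sgn D a] (change_signs_subproof D).

(* D' is, up to renaming of the arrows, D with the arrows in S deleted *)
Definition deletion D (S : {set arrow D}) (D' : gauss n) : Prop :=
  exists f : arrow D' -> arrow D,
    [/\ injective f,
        forall a, (a \in codom f) = (a \notin S),
        forall a, sgn D' a = sgn D (f a)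
      & forall i, [seq (f e.1, e.2) | e <- strand D' i]
                  = [seq e <- strand D i | e.1 \notin S]].

(* Nothing is deleted, so that the f above is a bijective renaming. *)
Definition diagram_iso D D' : Prop := @deletion D set0 D'.

Definition R1 D D' : Prop :=
  exists (a : arrow D) (b : bool),
    adjacent b (a, tail) (a, head) /\ deletion [set a] D'.

Definition R2 D D' : Prop :=
  exists (a1 a2 : arrow D) (bt bh : bool),
    [/\ a1 != a2, sgn D a1 = ~~ sgn D a2,
        adjacent bt (a1, tail) (a2, tail),
        adjacent bh (a1, head) (a2, head)
      & deletion [set a1; a2] D'].

(* aij runs from the portion s_i to the portion s_j.  On s_k, the endpoint named
   first is that of the arrow joining s_k and s_(k-1), indices mod 3.  Since the
   three arrows are distinct, the portions are disjoint. Exchanging two adjacent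
   endpoints amounts to transposing them. *)
Definition R3 D D' : Prop :=
  exists (a12 a23 a13 : arrow D) (eta1 eta2 eta3 : bool),
    [/\ uniq [:: a12; a23; a13],
        [/\ adjacent eta1 (a13, tail) (a12, tail),
            adjacent eta2 (a12, head) (a23, tail)
          & adjacent eta3 (a23, head) (a13, head)],
        (eps a12 * sg eta1 * sg eta2 = eps a23 * sg eta2 * sg eta3)%R,
        (eps a23 * sg eta2 * sg eta3 = - eps a13 * sg eta1 * sg eta3)%R
      & D' = permute_ends (tperm (a13, tail) (a12, tail) *
                           tperm (a12, head) (a23, tail) *
                           tperm (a23, head) (a13, head))%g].

Definition OC D D' : Prop :=
  exists (a1 a2 : arrow D) (b : bool),
    adjacent b (a1, tail) (a2, tail) /\
    D' = permute_ends (tperm (a1, tail) (a2, tail)).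

Definition welded_move D D' : Prop :=
  [\/ R1 D D', R2 D D', R3 D D' | OC D D'].

(* Portions s_1, s_2 carry the tails and s_3, s_4 the heads; aij runs from s_i to
   s_j. *)
Definition BP_config D (a13 a14 a23 a24 : arrow D) : Prop :=
  exists eta1 eta2 eta3 eta4 : bool,
    [/\ uniq [:: a13; a14; a23; a24],
        adjacent eta1 (a13, tail) (a14, tail) /\
        adjacent eta2 (a23, tail) (a24, tail),
        adjacent eta3 (a13, head) (a23, head) /\
        adjacent eta4 (a14, head) (a24, head)
      & exists c : int,
          [/\ (eps a13 * sg eta1 * sg eta3)%R = c,
              (eps a14 * sg eta1 * sg eta4)%R = c,
              (eps a23 * sg eta2 * sg eta3)%R = c
            & (eps a24 * sg eta2 * sg eta4)%R = c]].

(* [change_signs] and [reverse] keep the arrows of D, whence the conversions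
   between [arrow D], [arrow (change_signs S)] and [arrow (BP_result S)] below. *)
Definition BP_result D (S : {set arrow D}) : gauss n :=
  @reverse (change_signs S) S.

Definition SR_result D (a : arrow D) : gauss n := change_signs [set a].

Definition wBP D D' : Prop :=
  exists a13 a14 a23 a24 : arrow D,
    BP_config a13 a14 a23 a24 /\
    let S := [set a13; a14; a23; a24] in
    exists2 a, a \in S & D' = @SR_result (BP_result S) a.

End Operations.

(* A move mu is local when it can be performed inside a stacking; this is what
   makes stacking pass to the quotient by mu. *)
Record local_move n := LocalMove {
  move_rel :> gauss n -> gauss n -> Prop;
  move_stackl : forall E D D', move_rel D D' -> move_rel (stack E D) (stack E D');
  move_stackr : forall E D D', move_rel D D' -> move_rel (stack D E) (stack D' E)
}.

Definition welded_step n (mu : local_move n) (D D' : gauss n) : Prop :=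
  [\/ diagram_iso D D', welded_move D D' | mu D D'].

Definition welded_equiv n (mu : local_move n) : gauss n -> gauss n -> Prop :=
  clos_refl_sym_trans (gauss n) (welded_step mu).

Definition welded_equivb n (mu : local_move n) : rel (gauss n) :=
  fun D D' => `[< welded_equiv mu D D' >].

Section Quotient.
Variables (n : nat) (mu : local_move n).

Lemma welded_equivb_refl : reflexive (welded_equivb mu).
Proof. by move=> D; apply/asboolP; apply: rst_refl. Qed.

Lemma welded_equivb_sym : symmetric (welded_equivb mu).
Proof. by move=> D E; apply/asboolP/asboolP; apply: rst_sym. Qed.

Lemma welded_equivb_trans : transitive (welded_equivb mu).
Proof.
by move=> E D F /asboolP DE /asboolP EF; apply/asboolP; apply: rst_trans DE EF.
Qed.

Canonical welded_equiv_rel := EquivRel (welded_equivb mu)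
  welded_equivb_refl welded_equivb_sym welded_equivb_trans.

Definition wSL := {eq_quot welded_equiv_rel}.
HB.instance Definition _ := Choice.on wSL.
HB.instance Definition _ := EqQuotient.on wSL.

Lemma wSL_eqP (D D' : gauss n) : \pi_wSL D = \pi_wSL D' <-> welded_equiv mu D D'.
Proof. by split=> [/eqmodP/asboolP|?] //; apply/eqmodP/asboolP. Qed.

End Quotient.

Section StackMoves.
Variable n : nat.
Implicit Types D E : gauss n.

Lemma gauss_eq m (s s' : {ffun 'I_m -> bool})
    (w w' : {ffun 'I_n -> seq ('I_m * bool)}) p p' :
  s = s' -> w = w' -> @Gauss n m s w p = @Gauss n m s' w' p'.
Proof. by move=> es ew; subst s' w'; congr Gauss; apply: bool_irrelevance. Qed.

Lemma infix_map_s (T U : eqType) (f : T -> U) (s t : seq T) :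
  infix s t -> infix (map f s) (map f t).
Proof. by case/infixP => u [v ->]; rewrite !map_cat; apply: infix_infix. Qed.

Lemma adjacent_stackr E D b (x y : endpoint D) :
  adjacent b x y ->
  @adjacent n (stack D E) b (lend (narr E) x) (lend (narr E) y).
Proof.
case=> i xy; exists i; rewrite /= ffunE.
move/(infix_map_s (@lend (narr D) (narr E))): xy; case: b => /= xy;
exact: infix_catr.
Qed.

Lemma adjacent_stackl E D b (x y : endpoint D) :
  adjacent b x y ->
  @adjacent n (stack E D) b (rend (narr E) x) (rend (narr E) y).
Proof.
case=> i xy; exists i; rewrite /= ffunE.
move/(infix_map_s (@rend (narr E) (narr D))): xy; case: b => /= xy;
exact: infix_catl.
Qed.

Lemma eps_stackr E D (a : arrow D) :
  @eps n (stack D E) (lshift (narr E) a) = eps a.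
Proof. by rewrite /eps /= ffunE (unsplitK (inl _ a)). Qed.

Lemma eps_stackl E D (a : arrow D) :
  @eps n (stack E D) (rshift (narr E) a) = eps a.
Proof. by rewrite /eps /= ffunE (unsplitK (inr _ a)). Qed.

Lemma permute_stackr E D (p : {perm endpoint D}) (q : {perm endpoint (stack D E)}) :
  (forall x, q (lend (narr E) x) = lend (narr E) (p x)) ->
  (forall y, q (rend (narr D) y) = rend (narr D) y) ->
  stack (permute_ends p) E = permute_ends q.
Proof.
move=> ql qr; apply: gauss_eq; first by [].
apply/ffunP => i; rewrite !ffunE /= ?ffunE map_cat -!map_comp; congr cat; apply: eq_map => x /=; [by rewrite ql|by rewrite qr].
Qed.

Lemma permute_stackl E D (p : {perm endpoint D}) (q : {perm endpoint (stack E D)}) :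
  (forall x, q (rend (narr E) x) = rend (narr E) (p x)) ->
  (forall y, q (lend (narr D) y) = lend (narr D) y) ->
  stack E (permute_ends p) = permute_ends q.
Proof.
move=> qr ql; apply: gauss_eq; first by [].
apply/ffunP => i; rewrite !ffunE /= ?ffunE map_cat -!map_comp; congr cat; apply: eq_map => x /=; [by rewrite ql|by rewrite qr].
Qed.

Lemma deletion_stackr E D (S : {set arrow D}) D' :
  deletion S D' ->
  @deletion n (stack D E) [set lshift (narr E) a | a in S] (stack D' E).
Proof.
case=> f [finj fS fsgn fstr].
exists (fun a => match split a with inl b => lshift _ (f b) | inr b => rshift _ b end).
have im1 a : (lshift (narr E) a \in [set lshift (narr E) a | a in S]) = (a \in S).
  exact/mem_imset/lshift_inj.
have im2 a : (rshift (narr D) a \in [set lshift (narr E) a | a in S]) = false.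
  by apply/imsetP => -[b _ /eqP]; rewrite eq_rlshift.
split=> [a b|a|a|i].
- case: (split_ordP a) => a' ->; case: (split_ordP b) => b' ->.
  + by move/lshift_inj/finj ->.
  + by move/eqP; rewrite eq_lrshift.
  + by move/eqP; rewrite eq_rlshift.
  + by move/rshift_inj ->.
- case: (split_ordP a) => b ->.
  + rewrite im1 -fS; apply/codomP/codomP => -[c].
      case: (split_ordP c) => d _; first by move/lshift_inj ->; exists d.
      by move/eqP; rewrite eq_lrshift.
    by move=> ->; exists (lshift _ c); rewrite (unsplitK (inl _ c)).
  + rewrite im2; apply/codomP; exists (rshift _ b).
    by rewrite (unsplitK (inr _ b)).
- rewrite !ffunE; case: (split_ordP a) => b _.
  + by rewrite (unsplitK (inl _ (f b))) fsgn.
  + by rewrite (unsplitK (inr _ b)).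
- rewrite !ffunE map_cat filter_cat !filter_map -!map_comp; congr cat.
  + rewrite -(eq_filter (a1 := fun e : endpoint D => e.1 \notin S)) => [|e /=].
      rewrite -fstr -map_comp; apply: eq_map => e /=.
      by rewrite (unsplitK (inl _ e.1)).
    by rewrite im1.
  + rewrite (eq_filter (a2 := predT)) ?filter_predT => [|e /=].
      by apply: eq_map => e /=; rewrite (unsplitK (inr _ e.1)).
    by rewrite im2.
Qed.

Lemma deletion_stackl E D (S : {set arrow D}) D' :
  deletion S D' ->
  @deletion n (stack E D) [set rshift (narr E) a | a in S] (stack E D').
Proof.
case=> f [finj fS fsgn fstr].
exists (fun a => match split a with inl b => lshift _ b | inr b => rshift _ (f b) end).
have im1 a : (rshift (narr E) a \in [set rshift (narr E) a | a in S]) = (a \in S).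
  exact/mem_imset/rshift_inj.
have im2 a : (lshift (narr D) a \in [set rshift (narr E) a | a in S]) = false.
  by apply/imsetP => -[b _ /eqP]; rewrite eq_lrshift.
split=> [a b|a|a|i].
- case: (split_ordP a) => a' ->; case: (split_ordP b) => b' ->.
  + by move/lshift_inj ->.
  + by move/eqP; rewrite eq_lrshift.
  + by move/eqP; rewrite eq_rlshift.
  + by move/rshift_inj/finj ->.
- case: (split_ordP a) => b ->; last first.
  + rewrite im1 -fS; apply/codomP/codomP => -[c].
      case: (split_ordP c) => d _; last by move/rshift_inj ->; exists d.
      by move/eqP; rewrite eq_rlshift.
    by move=> ->; exists (rshift _ c); rewrite (unsplitK (inr _ c)).
  + rewrite im2; apply/codomP; exists (lshift _ b).
    by rewrite (unsplitK (inl _ b)).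
- rewrite !ffunE; case: (split_ordP a) => b _.
  + by rewrite (unsplitK (inl _ b)).
  + by rewrite (unsplitK (inr _ (f b))) fsgn.
- rewrite !ffunE map_cat filter_cat !filter_map -!map_comp; congr cat; last first.
  + rewrite -(eq_filter (a1 := fun e : endpoint D => e.1 \notin S)) => [|e /=].
      rewrite -fstr -map_comp; apply: eq_map => e /=.
      by rewrite (unsplitK (inr _ e.1)).
    by rewrite im1.
  + rewrite (eq_filter (a2 := predT)) ?filter_predT => [|e /=].
      by apply: eq_map => e /=; rewrite (unsplitK (inl _ e.1)).
    by rewrite im2.
Qed.

Lemma iso_stackr E D D' : diagram_iso D D' -> diagram_iso (stack D E) (stack D' E).
Proof. by move/(@deletion_stackr E); rewrite imset0. Qed.

Lemma iso_stackl E D D' : diagram_iso D D' -> diagram_iso (stack E D) (stack E D').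
Proof. by move/(@deletion_stackl E); rewrite imset0. Qed.

Lemma sgn_stackr E D (a : arrow D) :
  sgn (stack D E) (lshift (narr E) a) = sgn D a.
Proof. by rewrite /= ffunE (unsplitK (inl _ a)). Qed.

Lemma sgn_stackl E D (a : arrow D) :
  sgn (stack E D) (rshift (narr E) a) = sgn D a.
Proof. by rewrite /= ffunE (unsplitK (inr _ a)). Qed.

Lemma tperm_lend m1 m2 (x y z : 'I_m1 * bool) :
  tperm (lend m2 x) (lend m2 y) (lend m2 z) = lend m2 (tperm x y z).
Proof. by rewrite (inj_tperm _ _ _ (@lend_inj _ _)). Qed.

Lemma tperm_rend m1 m2 (x y z : 'I_m2 * bool) :
  tperm (rend m1 x) (rend m1 y) (rend m1 z) = rend m1 (tperm x y z).
Proof. by rewrite (inj_tperm _ _ _ (@rend_inj _ _)). Qed.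

Lemma tperm_lend_rend m1 m2 (x y : 'I_m1 * bool) (z : 'I_m2 * bool) :
  tperm (lend m2 x) (lend m2 y) (rend m1 z) = rend m1 z.
Proof. by rewrite tpermD ?lrend_neq. Qed.

Lemma tperm_rend_lend m1 m2 (x y : 'I_m2 * bool) (z : 'I_m1 * bool) :
  tperm (rend m1 x) (rend m1 y) (lend m2 z) = lend m2 z.
Proof. by rewrite tpermD // eq_sym lrend_neq. Qed.

Lemma welded_move_stackr E D D' :
  welded_move D D' -> welded_move (stack D E) (stack D' E).
Proof.
case.
- case=> a [b [adj /(@deletion_stackr E) del]]; apply: Or41.
  exists (lshift _ a), b; split; first exact: (adjacent_stackr E adj).
  by rewrite imset_set1 in del.
- case=> a1 [a2 [bt [bh [ne sg12 adt adh /(@deletion_stackr E) del]]]].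
  apply: Or42; exists (lshift _ a1), (lshift _ a2), bt, bh; split.
  + by rewrite eq_lshift.
  + by rewrite !sgn_stackr.
  + exact: (adjacent_stackr E adt).
  + exact: (adjacent_stackr E adh).
  + by rewrite imsetU1 imset_set1 in del.
- case=> a12 [a23 [a13 [e1 [e2 [e3 [u [d1 d2 d3] s1 s2 ->]]]]]].
  apply: Or43; exists (lshift _ a12), (lshift _ a23), (lshift _ a13), e1, e2, e3.
  split.
  + by rewrite -(map_inj_uniq (@lshift_inj _ (narr E))) in u.
  + split; [exact: (adjacent_stackr E d1)|exact: (adjacent_stackr E d2)|
            exact: (adjacent_stackr E d3)].
  + by rewrite !eps_stackr.
  + by rewrite !eps_stackr.
  + apply: permute_stackr => x; rewrite !permM.
    * by rewrite -!/(lend _ (_, _)) !tperm_lend.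
    * by rewrite -!/(lend _ (_, _)) !tperm_lend_rend.
- case=> a1 [a2 [b [adj ->]]]; apply: Or44.
  exists (lshift _ a1), (lshift _ a2), b; split; first exact: (adjacent_stackr E adj).
  apply: permute_stackr => x.
  + by rewrite -!/(lend _ (_, _)) !tperm_lend.
  + by rewrite -!/(lend _ (_, _)) !tperm_lend_rend.
Qed.

Lemma welded_move_stackl E D D' :
  welded_move D D' -> welded_move (stack E D) (stack E D').
Proof.
case.
- case=> a [b [adj /(@deletion_stackl E) del]]; apply: Or41.
  exists (rshift _ a), b; split; first exact: (adjacent_stackl E adj).
  by rewrite imset_set1 in del.
- case=> a1 [a2 [bt [bh [ne sg12 adt adh /(@deletion_stackl E) del]]]].
  apply: Or42; exists (rshift _ a1), (rshift _ a2), bt, bh; split.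
  + by rewrite eq_rshift.
  + by rewrite !sgn_stackl.
  + exact: (adjacent_stackl E adt).
  + exact: (adjacent_stackl E adh).
  + by rewrite imsetU1 imset_set1 in del.
- case=> a12 [a23 [a13 [e1 [e2 [e3 [u [d1 d2 d3] s1 s2 ->]]]]]].
  apply: Or43; exists (rshift _ a12), (rshift _ a23), (rshift _ a13), e1, e2, e3.
  split.
  + by rewrite -(map_inj_uniq (@rshift_inj (narr E) _)) in u.
  + split; [exact: (adjacent_stackl E d1)|exact: (adjacent_stackl E d2)|
            exact: (adjacent_stackl E d3)].
  + by rewrite !eps_stackl.
  + by rewrite !eps_stackl.
  + apply: permute_stackl => x; rewrite !permM.
    * by rewrite -!/(rend _ (_, _)) !tperm_rend.
    * by rewrite -!/(rend _ (_, _)) !tperm_rend_lend.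
- case=> a1 [a2 [b [adj ->]]]; apply: Or44.
  exists (rshift _ a1), (rshift _ a2), b; split; first exact: (adjacent_stackl E adj).
  apply: permute_stackl => x.
  + by rewrite -!/(rend _ (_, _)) !tperm_rend.
  + by rewrite -!/(rend _ (_, _)) !tperm_rend_lend.
Qed.

Lemma mem_imsetl m1 m2 (S : {set 'I_m1}) (a : 'I_m1) :
  (lshift m2 a \in [set lshift m2 b | b in S]) = (a \in S).
Proof. exact/mem_imset/lshift_inj. Qed.
Lemma mem_imsetr m1 m2 (S : {set 'I_m2}) (a : 'I_m2) :
  (rshift m1 a \in [set rshift m1 b | b in S]) = (a \in S).
Proof. exact/mem_imset/rshift_inj. Qed.
Lemma mem_imsetlr m1 m2 (S : {set 'I_m1}) (a : 'I_m2) :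
  (rshift m1 a \in [set lshift m2 b | b in S]) = false.
Proof. by apply/imsetP => -[b _ /eqP]; rewrite eq_rlshift. Qed.
Lemma mem_imsetrl m1 m2 (S : {set 'I_m2}) (a : 'I_m1) :
  (lshift m2 a \in [set rshift m1 b | b in S]) = false.
Proof. by apply/imsetP => -[b _ /eqP]; rewrite eq_lrshift. Qed.

Lemma wBP_result_stackr E D (S : {set arrow D}) (a : arrow D) :
  stack (@SR_result n (BP_result S) a) E =
  @SR_result n (@BP_result n (stack D E) [set lshift (narr E) b | b in S])
    (lshift (narr E) a).
Proof.
apply: gauss_eq; apply/ffunP => i; rewrite !ffunE /=.
- case: (split_ordP i) => b ->.
  + by rewrite mem_imsetl !ffunE /= !inE eq_lshift.
  + by rewrite mem_imsetlr !inE eq_rlshift.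
- rewrite ?ffunE map_cat -!map_comp; congr cat; apply: eq_map => x /=;
    rewrite !permE /reverse_ends /=.
  + by rewrite mem_imsetl.
  + by rewrite mem_imsetlr.
Qed.

Lemma wBP_result_stackl E D (S : {set arrow D}) (a : arrow D) :
  stack E (@SR_result n (BP_result S) a) =
  @SR_result n (@BP_result n (stack E D) [set rshift (narr E) b | b in S])
    (rshift (narr E) a).
Proof.
apply: gauss_eq; apply/ffunP => i; rewrite !ffunE /=.
- case: (split_ordP i) => b ->.
  + by rewrite mem_imsetrl !inE eq_lrshift.
  + by rewrite mem_imsetr !ffunE /= !inE eq_rshift.
- rewrite ?ffunE map_cat -!map_comp; congr cat; apply: eq_map => x /=;
    rewrite !permE /reverse_ends /=.
  + by rewrite mem_imsetrl.
  + by rewrite mem_imsetr.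
Qed.

Lemma wBP_stackr E D D' : wBP D D' -> wBP (stack D E) (stack D' E).
Proof.
case=> a13 [a14 [a23 [a24 [[e1 [e2 [e3 [e4 [u [t1 t2] [h3 h4] c]]]]] [a aS ->]]]]].
exists (lshift _ a13), (lshift _ a14), (lshift _ a23), (lshift _ a24); split.
  exists e1, e2, e3, e4; split.
  - by rewrite -(map_inj_uniq (@lshift_inj _ (narr E))) in u.
  - split; [exact: (adjacent_stackr E t1)|exact: (adjacent_stackr E t2)].
  - split; [exact: (adjacent_stackr E h3)|exact: (adjacent_stackr E h4)].
  - by rewrite !eps_stackr.
rewrite -!imset_set1 -!imsetU /=.
exists (lshift _ a); first by rewrite mem_imsetl.
exact: wBP_result_stackr.
Qed.

Lemma wBP_stackl E D D' : wBP D D' -> wBP (stack E D) (stack E D').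
Proof.
case=> a13 [a14 [a23 [a24 [[e1 [e2 [e3 [e4 [u [t1 t2] [h3 h4] c]]]]] [a aS ->]]]]].
exists (rshift _ a13), (rshift _ a14), (rshift _ a23), (rshift _ a24); split.
  exists e1, e2, e3, e4; split.
  - by rewrite -(map_inj_uniq (@rshift_inj (narr E) _)) in u.
  - split; [exact: (adjacent_stackl E t1)|exact: (adjacent_stackl E t2)].
  - split; [exact: (adjacent_stackl E h3)|exact: (adjacent_stackl E h4)].
  - by rewrite !eps_stackl.
rewrite -!imset_set1 -!imsetU /=.
exists (rshift _ a); first by rewrite mem_imsetr.
exact: wBP_result_stackl.
Qed.

Lemma iso_stackA D1 D2 D3 :
  diagram_iso (stack D1 (stack D2 D3)) (stack (stack D1 D2) D3).
Proof.
have cast1 a : cast_ord (esym (addnA (narr D1) (narr D2) (narr D3)))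
    (lshift _ (lshift _ a)) = lshift _ a by apply: val_inj.
have cast2 a : cast_ord (esym (addnA (narr D1) (narr D2) (narr D3)))
    (lshift _ (rshift _ a)) = rshift _ (lshift _ a) by apply: val_inj.
have cast3 a : cast_ord (esym (addnA (narr D1) (narr D2) (narr D3)))
    (rshift _ a) = rshift _ (rshift _ a) by apply: val_inj; rewrite /= addnA.
exists (cast_ord (esym (addnA (narr D1) (narr D2) (narr D3)))).
split=> [|a|a|i].
- exact: cast_ord_inj.
- rewrite inE; apply/codomP; exists (cast_ord (addnA _ _ _) a).
  by rewrite cast_ordK.
- rewrite !ffunE; case: (split_ordP a) => b ->.
    rewrite ffunE; case: (split_ordP b) => c ->.
      by rewrite cast1 (unsplitK (inl _ c)).
    by rewrite cast2 (unsplitK (inr _ (lshift _ c))) ffunE (unsplitK (inl _ c)).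
  by rewrite cast3 (unsplitK (inr _ (rshift _ b))) ffunE (unsplitK (inr _ b)).
- rewrite (eq_filter (a2 := predT)) ?filter_predT => [|e /=]; last by rewrite inE.
  rewrite !ffunE !map_cat -!map_comp -catA.
  by congr cat; [|congr cat]; apply: eq_map => e /=;
     rewrite /lend /rend /= ?cast1 ?cast2 ?cast3.
Qed.

Lemma iso_stack0 D : diagram_iso (stack (empty_gauss n) D) D.
Proof.
exists (@rshift 0 (narr D)); split=> [|a|a|i].
- exact: rshift_inj.
- rewrite inE; apply/codomP; case: (split_ordP a) => [[]//|b ->]; by exists b.
- by rewrite ffunE (unsplitK (inr _ a)).
- rewrite (eq_filter (a2 := predT)) ?filter_predT => [|e /=]; last by rewrite inE.
  by rewrite !ffunE.
Qed.

Lemma iso_stackr0 D : diagram_iso (stack D (empty_gauss n)) D.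
Proof.
exists (@lshift (narr D) 0); split=> [|a|a|i].
- exact: lshift_inj.
- rewrite inE; apply/codomP; case: (split_ordP a) => [b ->|[]//]; by exists b.
- by rewrite ffunE (unsplitK (inl _ a)).
- rewrite (eq_filter (a2 := predT)) ?filter_predT => [|e /=]; last by rewrite inE.
  by rewrite !ffunE /= cats0.
Qed.

End StackMoves.

Definition wBP_move n : local_move n := LocalMove (@wBP_stackl n) (@wBP_stackr n).

Section WSLMonoid.
Variables (n : nat) (mu : local_move n).

Lemma welded_equiv_stack D D' E E' :
  welded_equiv mu D D' -> welded_equiv mu E E' ->
  welded_equiv mu (stack D E) (stack D' E').
Proof.
move=> DD' EE'; apply: (@rst_trans _ _ _ (stack D' E)).
- elim: DD' => {D D'} [D D' st|D|D D' _ IH|D1 D2 D3 _ IH1 _ IH2].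
  + apply: rst_step; case: st => st.
    * by apply: Or31; apply: iso_stackr.
    * by apply: Or32; apply: welded_move_stackr.
    * by apply: Or33; apply: move_stackr.
  + exact: rst_refl.
  + exact: rst_sym.
  + exact: rst_trans IH1 IH2.
- elim: EE' => {E E'} [E E' st|E|E E' _ IH|E1 E2 E3 _ IH1 _ IH2].
  + apply: rst_step; case: st => st.
    * by apply: Or31; apply: iso_stackl.
    * by apply: Or32; apply: welded_move_stackl.
    * by apply: Or33; apply: move_stackl.
  + exact: rst_refl.
  + exact: rst_sym.
  + exact: rst_trans IH1 IH2.
Qed.

Definition wSL_mul (x y : wSL mu) : wSL mu :=
  \pi_(wSL mu) (stack (generic_quotient.repr x) (generic_quotient.repr y)).
Definition wSL_one : wSL mu := \pi_(wSL mu) (empty_gauss n).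

Lemma wSL_mul_pi D E :
  wSL_mul (\pi_(wSL mu) D) (\pi_(wSL mu) E) = \pi_(wSL mu) (stack D E).
Proof.
by apply/wSL_eqP/welded_equiv_stack; apply/wSL_eqP; rewrite reprK.
Qed.

Lemma iso_wSL D D' : diagram_iso D D' -> \pi_(wSL mu) D = \pi_(wSL mu) D'.
Proof. by move=> iso; apply/wSL_eqP; apply: rst_step; apply: Or31. Qed.

Lemma wSL_mulA : associative wSL_mul.
Proof.
elim/quotW => x; elim/quotW => y; elim/quotW => z.
rewrite (wSL_mul_pi y z) (wSL_mul_pi x y) (wSL_mul_pi x) (wSL_mul_pi _ z).
by apply: iso_wSL; apply: iso_stackA.
Qed.

Lemma wSL_mul1 : left_id wSL_one wSL_mul.
Proof. by elim/quotW => x; rewrite wSL_mul_pi; apply: iso_wSL; apply: iso_stack0. Qed.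

Lemma wSL_mulr1 : right_id wSL_one wSL_mul.
Proof. by elim/quotW => x; rewrite wSL_mul_pi; apply: iso_wSL; apply: iso_stackr0. Qed.

HB.instance Definition _ :=
  isMonoid.Build (wSL mu) wSL_mulA wSL_mul1 wSL_mulr1.

End WSLMonoid.

Section Invariants.
Variable n : nat.
Local Open Scope ring_scope.

Definition vlk (D : gauss n) (i j : 'I_n) : int :=
  \sum_(a : arrow D | ((a, tail) \in strand D i) && ((a, head) \in strand D j))
    eps a.

Definition vlk_mod (D : gauss n) (i j : 'I_n) : 'Z_2 := (vlk D i j)%:~R.

Definition vlk_star_mod (D : gauss n) (i : 'I_n) : 'Z_2 :=
  (\sum_(k < n | k != i) vlk D i k)%:~R.

Definition strand_pair := {p : 'I_n * 'I_n | (p.1 < p.2)%N}.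

Definition wBP_values := ({ffun strand_pair -> 'Z_2} * {ffun 'I_n.-1 -> 'Z_2})%type.

Definition wBP_inv (D : gauss n) : wBP_values :=
  ([ffun p : strand_pair =>
      vlk_mod D (val p).1 (val p).2 + vlk_mod D (val p).2 (val p).1],
   [ffun i : 'I_n.-1 => vlk_star_mod D (widen_ord (leq_pred n) i)]).

End Invariants.

(* Main.v *)
From Stdlib Require Import Relation_Operators.
Require Import Defs.
From HB Require Import structures.
From mathcomp Require Import all_boot all_order all_fingroup all_algebra.
From mathcomp Require Import boolp zify.

(** The invariant only sees the numbers of arrows between strands, modulo 2.
    Moves R1, R2, R3 and OC keep these numbers, up to arrows from a strand to
    itself and pairs of parallel arrows of opposite signs.  A wBP move reverses
    four arrows; this does not affect the unordered pairs of strands that they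
    join, and it changes the number of arrows leaving a strand by an even amount
    since each of the four portions carries two endpoints ([wBP_inv_wBP]).

    The substance is that nothing else survives in the quotient.  The argument
    shows successively that the following hold up to welded moves and wBP.

    - Signs are irrelevant ([cls_sign]).  Take two parallel arrows of equal signs,
      and insert by R2 a pair of arrows whose tails come between theirs; the four
      arrows are then the outcome of a wBP move, and undoing this move turns the
      two given arrows into a pair that R2 deletes ([cls_R2_same]).  So R2 holds for
      equal signs as well, and the two versions of R2 together flip a sign.

    - Any two adjacent endpoints can be exchanged ([ucls_swap]).  Tails commute by
      OC.  Reversing four arrows in a band-pass configuration, exchanging two tails
      and reversing again exchanges two heads; auxiliary arrows created by R1
      and R2 complete any two adjacent heads to such a configuration ([ucls_HC]).
      Finally R3 with an auxiliary third arrow exchanges a head and a tail, at the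
      price of exchanges of two tails and of two heads ([ucls_HT]).

    - Hence the monoid is commutative and generated by the classes [arr i j] of the
      diagrams with a single arrow, from strand i to strand j ([wsl_ind]).  They
      satisfy [arr i i = 1] by R1, [arr i j * arr i j = 1] by R2, and a band-pass
      with two of its portions on strand i gives the relation [arr_triangle], which
      reverses the three sides of a triangle.

    So the quotient is an elementary abelian 2-group.  The invariant tells for each
    pair of strands whether an odd number of arrows join them, and for each strand
    the parity of the number of arrows leaving it.  Two products of generators with
    the same invariant differ by reversing a set of arrows whose edges form a graph
    with even degrees; such graphs are sums of triangles through the last strand.
    Concretely, the products [pair_gen] and [star_gen] have the basis of the target
    as values, and the triangle relations with apex the last strand express every
    [arr i j] through them, so that [word_of] inverts the invariant. *)

Set Implicit Arguments.
Unset Strict Implicit.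
Unset Printing Implicit Defensive.

Import GRing.Theory.

Local Notation tail := false (only parsing).
Local Notation head := true (only parsing).

(** * Diagrams as words *)

Section Words.
Variable n : nat.
Notation letter := ('I_n * (nat * bool))%type.
Notation word := (seq letter).
Implicit Types (L : word) (s : nat -> bool) (D : gauss n).

(** A letter (i, (a, b)) is the endpoint of side b of the arrow named a, on strand i.
    A word lists the endpoints of all strands at once; only the order of letters on
    the same strand matters.  Words are easier to cut and paste than diagrams:
    arrow names need not be consecutive, so that insertions and deletions keep the
    names of the other arrows. *)
Definition ends L := [seq x.2 | x <- L].

Definition labels L := [seq x.2.1 | x <- L].

Definition on_strand (i : 'I_n) L := [seq x.2 | x <- L & x.1 == i].

Definition balanced (w : seq (nat * bool)) :=
  uniq w && all (fun e => (e.1, ~~ e.2) \in w) w.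

Definition valid L := balanced (ends L).

(** Signs are kept outside the word, as a function of the names: a change of sign
    then leaves the word as it is. *)
Definition realizes s L D (f : arrow D -> nat) :=
  [/\ injective f, forall a, sgn D a = s (f a)
    & forall i, [seq (f e.1, e.2) | e <- strand D i] = on_strand i L].

Lemma mem_on_strand i e L : (e \in on_strand i L) = ((i, e) \in L).
Proof.
apply/mapP/idP => [[[j e'] + ->]|iL]; first by rewrite mem_filter /= => /andP[/eqP-> ].
by exists (i, e); rewrite // mem_filter eqxx.
Qed.

Lemma mem_ends e L : reflect (exists i, (i, e) \in L) (e \in ends L).
Proof.
by apply: (iffP mapP) => [[[i e'] xL ->]|[i iL]]; [exists i | exists (i, e)].
Qed.

Lemma labels_ends L : labels L = [seq e.1 | e <- ends L].
Proof. by rewrite -map_comp. Qed.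

Lemma mem_labels a b L : (a, b) \in ends L -> a \in labels L.
Proof. by rewrite labels_ends => /(map_f fst). Qed.

Lemma count_on_strand e L :
  \sum_(i < n) count_mem e (on_strand i L) = count_mem e (ends L).
Proof.
rewrite (eq_bigr (fun i => \sum_(x <- L | x.1 == i) (x.2 == e))); last first.
  by move=> i _; rewrite -sum1_count big_map big_filter_cond big_mkcondr.
rewrite (exchange_big_dep xpredT) //= -sum1_count big_map [RHS]big_mkcond /=.
apply: eq_bigr => x _; rewrite (big_pred1 x.1); first by case: eqP.
by move=> i; rewrite eq_sym.
Qed.

Lemma end_map_inj (S T : Type) (f : S -> T) :
  injective f -> injective (fun e : S * bool => (f e.1, e.2)).
Proof. by move=> f_inj [a b] [c d] [/f_inj-> ->]. Qed.

Lemma realizes_count s L D (f : arrow D -> nat) (e : endpoint D) :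
  realizes s L f -> count_mem (f e.1, e.2) (ends L) = 1.
Proof.
case=> f_inj _ fL; rewrite -count_on_strand -[RHS](gauss_once e).
apply: eq_bigr => i _; rewrite -fL count_map; apply: eq_count => x /=.
by rewrite (inj_eq (end_map_inj f_inj) x e).
Qed.

Lemma realizes_mem s L D (f : arrow D -> nat) a b :
  realizes s L f -> (f a, b) \in ends L.
Proof.
by move=> r; rewrite -has_pred1 has_count (realizes_count (a, b) r).
Qed.

Lemma realizes_surj s L D (f : arrow D -> nat) c :
  realizes s L f -> c \in labels L -> exists a, f a = c.
Proof.
case=> _ _ fL /mapP[[i [x b]]] /=; rewrite -mem_on_strand -fL => /mapP[[a d]] _ [-> _] ->.
by exists a.
Qed.

Lemma realizes_valid s L D (f : arrow D -> nat) : realizes s L f -> valid L.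
Proof.
move=> r; have im e : e \in ends L -> exists a, e = (f a, e.2).
  case: e => c b cb; have [a <-] := realizes_surj r (mem_labels cb).
  by exists a.
apply/andP; split.
  apply: count_mem_uniq => e; case: (boolP (e \in _)) => [/im[a ->]|eL].
    by rewrite (realizes_count (a, e.2) r).
  by apply/count_memPn.
by apply/allP => e /im[a ->]; apply: realizes_mem r.
Qed.

Lemma map_surj (T U : eqType) (F : T -> U) (w : seq U) :
  (forall y, y \in w -> exists x, F x = y) -> exists w', map F w' = w.
Proof.
elim: w => [|y w IH] im; first by exists [::].
have [x Fx] := im y (mem_head _ _).
have [|w' Fw'] := IH; first by move=> z zw; apply: im; rewrite inE zw orbT.
by exists (x :: w'); rewrite /= Fx Fw'.
Qed.

Lemma valid_count L a b : valid L -> a \in labels L -> count_mem (a, b) (ends L) = 1.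
Proof.
case/andP=> uL bL aL; rewrite count_uniq_mem //.
move: aL; rewrite labels_ends => /mapP[[c d] cd ->] /=.
case: (altP (b =P d)) => [->|]; first by rewrite cd.
by case: b d cd => -[] //= /(allP bL) /= ->.
Qed.

(** The arrows of the diagram are numbered in the order of their names in L. *)
Lemma realizable s L : valid L -> exists D (f : arrow D -> nat), realizes s L f.
Proof.
move=> vL; pose A := undup (labels L).
pose f (k : 'I_(size A)) := nth 0 A k.
have f_inj : injective f.
  by move=> k k' /eqP; rewrite nth_uniq ?undup_uniq // => /eqP/val_inj.
have fA k : f k \in labels L by rewrite -mem_undup mem_nth.
have [w fw] : exists w : 'I_n -> seq ('I_(size A) * bool),
    forall i, [seq (f e.1, e.2) | e <- w i] = on_strand i L.
  apply: (fin_all_exists (P := fun i wi => [seq (f e.1, e.2) | e <- wi] = on_strand i L)).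
  move=> i; apply: map_surj => -[c b]; rewrite mem_on_strand => cb.
  have cA : c \in A by rewrite mem_undup; apply/mapP; exists (i, (c, b)).
  have cs : index c A < size A by rewrite index_mem.
  by exists (Ordinal cs, b); rewrite /f /= nth_index.
have ok : [forall e : 'I_(size A) * bool,
    \sum_(i < n) count_mem e ([ffun i => w i] i) == 1].
  apply/forallP => e; apply/eqP; rewrite -[RHS](valid_count e.2 vL (fA e.1)).
  rewrite -count_on_strand; apply: eq_bigr => i _; rewrite ffunE -fw count_map.
  by apply: eq_count => x /=; rewrite (inj_eq (end_map_inj f_inj) x e).
exists (@Gauss n _ [ffun k => s (f k)] _ ok), f; split=> // [a|i].
  by rewrite ffunE.
by rewrite ffunE fw.
Qed.

Lemma on_strand_cat i L1 L2 : on_strand i (L1 ++ L2) = on_strand i L1 ++ on_strand i L2.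
Proof. by rewrite /on_strand filter_cat map_cat. Qed.

Lemma on_strand_pair i j (w : seq (nat * bool)) :
  on_strand i [seq (j, e) | e <- w] = if i == j then w else [::].
Proof.
rewrite eq_sym /on_strand filter_map -map_comp; case: eqP => [->|/eqP/negPf ij].
  rewrite (eq_filter (a2 := predT)) ?filter_predT ?map_id // => e /=.
  by rewrite eqxx.
by rewrite (eq_filter (a2 := pred0)) ?filter_pred0 // => e /=; rewrite ij.
Qed.

(** The strands are read one after the other, each arrow named by its number. *)
Lemma has_word D :
  exists s L, realizes s L (@nat_of_ord (narr D)).
Proof.
exists (fun k => if insub k is Some a then sgn D a else true).
pose w i := [seq (val e.1, e.2) | e <- strand D i].
exists (flatten [seq [seq (i, e) | e <- w i] | i <- enum 'I_n]).
split=> [|a|i]; [exact: val_inj | by rewrite valK |].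
rewrite -[LHS]/(w i).
have: uniq (enum 'I_n) by apply: enum_uniq.
have: i \in enum 'I_n by rewrite mem_enum.
have none r : i \notin r -> on_strand i (flatten [seq [seq (j, e) | e <- w j] | j <- r]) = [::].
  elim: r => //= k r IH; rewrite inE negb_or => /andP[ik /IH IHr].
  by rewrite on_strand_cat on_strand_pair (negPf ik) IHr.
elim: (enum 'I_n) => //= j r IH; rewrite inE on_strand_cat on_strand_pair.
case: eqP => [<- _ /andP[jr _]|_ /= ir /andP[_ /(IH ir)->]] //.
by rewrite none ?cats0.
Qed.

(** * Moves on words *)

Definition del (A : seq nat) L := [seq x <- L | x.2.1 \notin A].

Lemma ends_del A L : ends (del A L) = [seq e <- ends L | e.1 \notin A].
Proof. by rewrite /ends filter_map. Qed.

Lemma labels_del A L : labels (del A L) = [seq a <- labels L | a \notin A].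
Proof. by rewrite /labels filter_map. Qed.

Lemma valid_del A L : valid L -> valid (del A L).
Proof.
case/andP=> uL bL; rewrite /valid ends_del /balanced filter_uniq //=.
apply/allP => e; rewrite !mem_filter => /andP[-> /(allP bL)] //.
Qed.

Lemma on_strand_del A i L : on_strand i (del A L) = [seq e <- on_strand i L | e.1 \notin A].
Proof.
by rewrite /on_strand filter_map -!filter_predI; congr map; apply: eq_filter => x /=; rewrite andbC.
Qed.

(** With an empty A this says that a word determines its diagram up to
    isomorphism. *)
Lemma realizes_deletion s A L D D' (f : arrow D -> nat) (f' : arrow D' -> nat) :
  realizes s L f -> realizes s (del A L) f' -> deletion [set a | f a \in A] D'.
Proof.
move=> r r'; have [f_inj fs fL] := r; have [f'_inj f's f'L] := r'.
have [g fg] : exists g : arrow D' -> arrow D, forall a, f (g a) = f' a.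
  apply: (fin_all_exists (P := fun a c => f c = f' a)) => a; apply: (realizes_surj r).
  have := mem_labels (realizes_mem a true r').
  by rewrite labels_del mem_filter => /andP[].
exists g; split=> [a c /(congr1 f)|a|a|i].
- by rewrite !fg => /f'_inj.
- rewrite inE; apply/codomP/idP => [[c ->]|fa].
    rewrite fg; have := mem_labels (realizes_mem c true r').
    by rewrite labels_del mem_filter => /andP[].
  have [|c fc] := @realizes_surj _ _ _ _ (f a) r'.
    by rewrite labels_del mem_filter fa (mem_labels (realizes_mem a true r)).
  by exists c; apply: f_inj; rewrite fg.
- by rewrite f's fs fg.
- apply: (inj_map (end_map_inj f_inj)); rewrite -map_comp.
  rewrite (eq_map (g := fun e => (f' e.1, e.2))) => [|e /=]; last by rewrite fg.
  rewrite f'L on_strand_del -fL filter_map; congr map; apply: eq_filter => e /=.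
  by rewrite inE.
Qed.

Lemma del0 L : del [::] L = L.
Proof. by rewrite /del filter_predT. Qed.

Lemma realizes_iso s L D D' (f : arrow D -> nat) (f' : arrow D' -> nat) :
  realizes s L f -> realizes s L f' -> diagram_iso D D'.
Proof.
move=> r r'; rewrite -(del0 L) in r'; have := realizes_deletion r r'.
by congr (deletion _ _); apply/setP => a; rewrite !inE.
Qed.

Notation wsl := (wSL (wBP_move n)).

(** The class of the diagrams with a given word.  As a function on all words, with a
    dummy value at those which are not valid, it turns moves into equations. *)
Definition cls s L : wsl :=
  if pselect (exists D (f : arrow D -> nat), realizes s L f) is left ex
  then (\pi_wsl (projT1 (cid ex)))%qT else 1%g.

Lemma cls_realizes s L D (f : arrow D -> nat) :
  realizes s L f -> cls s L = (\pi_wsl D)%qT.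
Proof.
move=> r; rewrite /cls; case: pselect => [ex|[]]; last by exists D, f.
by case: cid => D' /= [f' r']; apply: iso_wSL; apply: realizes_iso r' r.
Qed.

Lemma clsP s L : valid L ->
  exists D (f : arrow D -> nat), realizes s L f /\ cls s L = (\pi_wsl D)%qT.
Proof.
by case/(realizable s) => D [f r]; exists D, f; split=> //; apply: cls_realizes r.
Qed.

Lemma welded_wSL D D' : welded_move D D' -> (\pi_wsl D = \pi_wsl D')%qT.
Proof. by move=> m; apply/wSL_eqP/rst_step; apply: Or32. Qed.

Lemma wBP_wSL D D' : wBP D D' -> (\pi_wsl D = \pi_wsl D')%qT.
Proof. by move=> m; apply/wSL_eqP/rst_step; apply: Or33. Qed.

End Words.

Section Moves.
Variable n : nat.
Notation letter := ('I_n * (nat * bool))%type.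
Notation word := (seq letter).
Notation wsl := (wSL (wBP_move n)).
Implicit Types (L : word) (s : nat -> bool) (D : gauss n).

(** Requires the two letters to be neighbours in the word, which is more than
    adjacency on a strand: other strands do not interfere. *)
Definition adj (b : bool) (x y : nat * bool) L :=
  exists i : 'I_n, infix (if b then [:: (i, x); (i, y)] else [:: (i, y); (i, x)]) L.

Lemma adjC b x y L : adj b x y L -> adj (~~ b) y x L.
Proof. by case=> i xy; exists i; case: b xy. Qed.

Lemma adj_ends b x y L : adj b x y L -> x \in ends L /\ y \in ends L.
Proof.
case=> i /mem_infix xy; split; apply/mem_ends; exists i; apply: xy;
by case: b; rewrite !inE eqxx ?orbT.
Qed.

(** This is how a factor of the word is brought back to a factor of a strand. *)
Lemma adj_adjacent s L D (f : arrow D -> nat) b (x y : endpoint D) :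
  realizes s L f -> adj b (f x.1, x.2) (f y.1, y.2) L -> adjacent b x y.
Proof.
case=> f_inj _ fL [i xy]; exists i.
have sub (u v : endpoint D) : infix [:: (i, (f u.1, u.2)); (i, (f v.1, v.2))] L ->
    infix [:: u; v] (strand D i).
  case/infixP => L1 [L2 eL]; have := fL i.
  rewrite eL !on_strand_cat /on_strand /= eqxx /=.
  set l1 := map snd _; move=> e; have e1 := congr1 (take (size l1)) e; have e2 := congr1 (drop (size l1)) e.
  rewrite -map_take take_size_cat // in e1; rewrite -map_drop drop_size_cat // in e2.
  rewrite -(cat_take_drop (size l1) (strand D i)); move: e2.
  case: (drop _ _) => [//|u' [//|v' r]] /= [Fu Fu2 Fv Fv2 _].
  have -> : u' = u by rewrite [u]surjective_pairing -(f_inj _ _ Fu) -Fu2 -surjective_pairing.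
  have -> : v' = v by rewrite [v]surjective_pairing -(f_inj _ _ Fv) -Fv2 -surjective_pairing.
  by apply/infixP; exists (take (size l1) (strand D i)), r.
by case: b xy => /sub.
Qed.

Definition relabel (p : nat * bool -> nat * bool) L : word := [seq (x.1, p x.2) | x <- L].

Lemma ends_relabel p L : ends (relabel p L) = map p (ends L).
Proof. by rewrite /ends -!map_comp. Qed.

Lemma on_strand_relabel p i L : on_strand i (relabel p L) = map p (on_strand i L).
Proof. by rewrite /on_strand filter_map -!map_comp. Qed.

Lemma adj_relabel p b x y L : adj b x y L -> adj b (p x) (p y) (relabel p L).
Proof.
by case=> i /(infix_map_s (fun z : letter => (z.1, p z.2))) xy; exists i; case: b xy.
Qed.

Lemma realizes_permute s L D (f : arrow D -> nat) (p : {perm endpoint D}) q :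
    realizes s L f -> (forall e, (f (p e).1, (p e).2) = q (f e.1, e.2)) ->
  realizes s (relabel q L) (f : arrow (permute_ends p) -> nat).
Proof.
case=> f_inj fs fL pq; split=> // i.
rewrite ffunE -map_comp on_strand_relabel -fL -map_comp.
by apply: eq_map => e /=; rewrite pq.
Qed.

Definition swap (x y e : nat * bool) := if e == x then y else if e == y then x else e.

Lemma swapl x y : swap x y x = y.
Proof. by rewrite /swap eqxx. Qed.

Lemma swapr x y : swap x y y = x.
Proof. by rewrite /swap eqxx; case: eqP. Qed.

Lemma swapN x y e : e != x -> e != y -> swap x y e = e.
Proof. by rewrite /swap => /negPf-> /negPf->. Qed.

Lemma swapK x y : involutive (swap x y).
Proof.
move=> e; rewrite {2}/swap; case: eqP => [->|ex]; first exact: swapr.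
by case: eqP => [->|ey]; [apply: swapl | apply: swapN; apply/eqP].
Qed.

Lemma swap_inj x y : injective (swap x y).
Proof. exact: inv_inj (swapK x y). Qed.

Lemma tperm_swap D (f : arrow D -> nat) (x y e : endpoint D) : injective f ->
  (f (tperm x y e).1, (tperm x y e).2) = swap (f x.1, x.2) (f y.1, y.2) (f e.1, e.2).
Proof.
move=> /end_map_inj f_inj; case: tpermP => [->|->|/eqP ex /eqP ey].
- by rewrite swapl.
- by rewrite swapr.
- by rewrite swapN // (inj_eq f_inj e).
Qed.

Lemma realizes_label s L D (f : arrow D -> nat) a b :
  realizes s L f -> (a, b) \in ends L -> exists c, f c = a.
Proof. by move=> r /mem_labels; apply: realizes_surj r. Qed.

Lemma realizes_ext s s' L D (f : arrow D -> nat) :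
  {in labels L, s =1 s'} -> realizes s L f -> realizes s' L f.
Proof.
move=> ss' r; have [f_inj fs fL] := r; split=> // a.
by rewrite fs ss' // (mem_labels (realizes_mem a true r)).
Qed.

Lemma cls_ext s s' L : valid L -> {in labels L, s =1 s'} -> cls s L = cls s' L.
Proof.
move=> vL ss'; have [D [f [r ->]]] := clsP s vL.
by rewrite (cls_realizes (realizes_ext ss' r)).
Qed.

(** Letters on different strands may be permuted: they describe the same diagram. *)
Lemma cls_strands s L L' : valid L ->
  (forall i, on_strand i L = on_strand i L') -> cls s L = cls s L'.
Proof.
move=> vL e; have [D [f [r ->]]] := clsP s vL.
by case: r => ? ? fL; apply/esym/(cls_realizes (f := f)); split=> // i; rewrite -e fL.
Qed.

Definition rename (g : nat -> nat) := relabel (fun e => (g e.1, e.2)).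

Lemma cls_rename g s s' L : valid L -> {in labels L &, injective g} ->
  {in labels L, forall a, s' (g a) = s a} -> cls s L = cls s' (rename g L).
Proof.
move=> vL g_inj gs; have [D [f [r ->]]] := clsP s vL; apply/esym.
have [f_inj fs fL] := r.
have fl a : f a \in labels L by exact: mem_labels (realizes_mem a true r).
apply: (cls_realizes (f := g \o f)); split=> [a b /= /g_inj|a|i].
- by move/(_ (fl a) (fl b))/f_inj.
- by rewrite /= gs.
- by rewrite on_strand_relabel -fL -map_comp.
Qed.

Lemma cls_R1 s L a b : valid L -> adj b (a, tail) (a, head) L ->
  cls s L = cls s (del [:: a] L).
Proof.
move=> vL adjL; have [aL _] := adj_ends adjL.
have [D [f [r ->]]] := clsP s vL; have [D' [f' [r' ->]]] := clsP s (valid_del [:: a] vL).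
have [c fc] := realizes_label r aL; apply/welded_wSL/Or41; exists c, b; split.
  by apply: (adj_adjacent r); rewrite /= fc.
suff -> : [set c] = [set x | f x \in [:: a]] by apply: realizes_deletion r r'.
by case: r => f_inj _ _; apply/setP => x; rewrite !inE -fc (inj_eq f_inj).
Qed.

Lemma cls_R2 s L a c bt bh : valid L -> a != c -> s a = ~~ s c ->
  adj bt (a, tail) (c, tail) L -> adj bh (a, head) (c, head) L ->
  cls s L = cls s (del [:: a; c] L).
Proof.
move=> vL ac sac adjt adjh; have [aL cL] := adj_ends adjt.
have [D [f [r ->]]] := clsP s vL; have [D' [f' [r' ->]]] := clsP s (valid_del [:: a; c] vL).
have [x fx] := realizes_label r aL; have [y fy] := realizes_label r cL.
have [f_inj fs _] := r.
apply/welded_wSL/Or42; exists x, y, bt, bh; split.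
- by apply: contraNneq ac => xy; rewrite -fx -fy xy.
- by rewrite !fs fx fy.
- by apply: (adj_adjacent r); rewrite /= fx fy.
- by apply: (adj_adjacent r); rewrite /= fx fy.
suff -> : [set x; y] = [set z | f z \in [:: a; c]] by apply: realizes_deletion r r'.
by apply/setP => z; rewrite !inE -fx -fy !(inj_eq f_inj).
Qed.

Lemma cls_OC s L a c b : valid L -> adj b (a, tail) (c, tail) L ->
  cls s L = cls s (relabel (swap (a, tail) (c, tail)) L).
Proof.
move=> vL adjL; have [aL cL] := adj_ends adjL; have [D [f [r ->]]] := clsP s vL.
have [x fx] := realizes_label r aL; have [y fy] := realizes_label r cL.
have [f_inj _ _] := r.
rewrite (cls_realizes (realizes_permute (p := tperm (x, tail) (y, tail)) r _)).
  apply/welded_wSL/Or44; exists x, y, b; split=> //.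
  by apply: (adj_adjacent r); rewrite /= fx fy.
by move=> e; rewrite tperm_swap //= fx fy.
Qed.

Lemma cls_R3 s L a12 a23 a13 b1 b2 b3 : valid L -> uniq [:: a12; a23; a13] ->
  adj b1 (a13, tail) (a12, tail) L -> adj b2 (a12, head) (a23, tail) L ->
  adj b3 (a23, head) (a13, head) L ->
  (sg (s a12) * sg b1 * sg b2 = sg (s a23) * sg b2 * sg b3)%R ->
  (sg (s a23) * sg b2 * sg b3 = - sg (s a13) * sg b1 * sg b3)%R ->
  cls s L = cls s (relabel (fun e => swap (a23, head) (a13, head)
    (swap (a12, head) (a23, tail) (swap (a13, tail) (a12, tail) e))) L).
Proof.
move=> vL u adj1 adj2 adj3 e1 e2; have [D [f [r ->]]] := clsP s vL.
have [x fx] := realizes_label r (adj_ends adj2).1.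
have [y fy] := realizes_label r (adj_ends adj3).1.
have [z fz] := realizes_label r (adj_ends adj1).1.
have [f_inj fs _] := r.
rewrite (cls_realizes (realizes_permute (p := (tperm (z, tail) (x, tail) *
  tperm (x, head) (y, tail) * tperm (y, head) (z, head))%g) r _)).
  apply/welded_wSL/Or43; exists x, y, z, b1, b2, b3; split=> //.
  - by rewrite -(map_inj_uniq f_inj) /= fx fy fz.
  - by split; apply: (adj_adjacent r); rewrite /= ?fx ?fy ?fz.
  - by rewrite /eps !fs fx fy.
  - by rewrite /eps !fs fy fz.
by move=> e; rewrite !permM !tperm_swap //= fx fy fz.
Qed.

Definition rev_in (A : seq nat) (e : nat * bool) := (e.1, (e.1 \in A) (+) e.2).

Lemma rev_inK A : involutive (rev_in A).
Proof. by case=> a b; rewrite /rev_in /= addKb. Qed.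

(** The arrow a takes part in the band-pass and in the sign reversal, hence the two
    additions modulo 2. *)
Lemma cls_wBP s L a13 a14 a23 a24 b1 b2 b3 b4 a c (S := [:: a13; a14; a23; a24]) :
  valid L -> uniq S -> a \in S ->
  adj b1 (a13, tail) (a14, tail) L -> adj b2 (a23, tail) (a24, tail) L ->
  adj b3 (a13, head) (a23, head) L -> adj b4 (a14, head) (a24, head) L ->
  [/\ (sg (s a13) * sg b1 * sg b3)%R = c, (sg (s a14) * sg b1 * sg b4)%R = c,
      (sg (s a23) * sg b2 * sg b3)%R = c & (sg (s a24) * sg b2 * sg b4)%R = c] ->
  cls s L = cls (fun z => (z == a) (+) ((z \in S) (+) s z)) (relabel (rev_in S) L).
Proof.
move=> vL u aS adj1 adj2 adj3 adj4 e; have [D [f [r ->]]] := clsP s vL.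
have [x13 f13] := realizes_label r (adj_ends adj1).1.
have [x14 f14] := realizes_label r (adj_ends adj1).2.
have [x23 f23] := realizes_label r (adj_ends adj2).1.
have [x24 f24] := realizes_label r (adj_ends adj2).2.
have [f_inj fs fL] := r.
pose S' := [set x13; x14; x23; x24].
have fS y : (f y \in S) = (y \in S').
  by rewrite !inE -f13 -f14 -f23 -f24 !(inj_eq f_inj) -!orbA.
have [x fx] : exists x, f x = a.
  by move: aS; rewrite !inE => /or4P[] /eqP->; [exists x13|exists x14|exists x23|exists x24].
rewrite (cls_realizes (D := @SR_result n (@BP_result n D S') x) (f := f)).
  apply: wBP_wSL; exists x13, x14, x23, x24; split; last first.
    by exists x; rewrite // -fS fx.
  exists b1, b2, b3, b4; split.
  - by rewrite -(map_inj_uniq f_inj) /= f13 f14 f23 f24.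
  - by split; apply: (adj_adjacent r); rewrite /= ?f13 ?f14 ?f23 ?f24.
  - by split; apply: (adj_adjacent r); rewrite /= ?f13 ?f14 ?f23 ?f24.
  - by exists c; rewrite /eps !fs f13 f14 f23 f24.
split=> // [y|i].
  by rewrite !ffunE fs fS inE -fx (inj_eq f_inj).
rewrite ffunE on_strand_relabel -fL -!map_comp; apply: eq_map => y /=.
by rewrite permE /rev_in /= fS.
Qed.

End Moves.

(** * Insertion of arrows *)

Section Insertion.
Variable n : nat.
Notation letter := ('I_n * (nat * bool))%type.
Notation word := (seq letter).
Implicit Types (L : word) (s : nat -> bool) (e : nat * bool) (w : seq (nat * bool)).

(** All auxiliary arrows are inserted right after given endpoints.  This cannot
    separate a pair of adjacent endpoints unless it takes place after the first of
    them, see [adj_after]; and it avoids any discussion of the relative position of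
    the places of insertion. *)
Definition after e w L : word :=
  flatten [seq x :: (if x.2 == e then [seq (x.1, y) | y <- w] else [::]) | x <- L].

Lemma after_cat e w L1 L2 : after e w (L1 ++ L2) = after e w L1 ++ after e w L2.
Proof. by rewrite /after map_cat flatten_cat. Qed.

Lemma after_cons e w x L :
  after e w (x :: L) =
  x :: (if x.2 == e then [seq (x.1, y) | y <- w] else [::]) ++ after e w L.
Proof. by []. Qed.

Lemma after_nil e L : after e [::] L = L.
Proof. by elim: L => // x L IH; rewrite after_cons IH; case: ifP. Qed.

Lemma del_cat A L1 L2 : del A (L1 ++ L2) = del A L1 ++ del A L2.
Proof. exact: filter_cat. Qed.

Lemma del_cons A x L : del A (x :: L) = if x.2.1 \notin A then x :: del A L else del A L.
Proof. by []. Qed.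

Lemma del_after A e w L : e.1 \notin A ->
  del A (after e w L) = after e [seq y <- w | y.1 \notin A] (del A L).
Proof.
move=> eA; elim: L => // x L IH; rewrite after_cons !del_cons del_cat IH.
have [xe|xe] := eqVneq x.2 e; last by case: ifP => xA; rewrite ?after_cons //= (negPf xe).
by rewrite xe eA after_cons xe eqxx /del filter_map.
Qed.

Lemma relabel_after p e w L : injective p ->
  relabel p (after e w L) = after (p e) (map p w) (relabel p L).
Proof.
move=> p_inj; elim: L => // x L IH; rewrite after_cons /= after_cons /= -IH (inj_eq p_inj).
by rewrite [relabel p (_ ++ _)]map_cat; case: ifP => // _; rewrite -!map_comp.
Qed.

Lemma ends_pair (i : 'I_n) w : ends [seq (i, y) | y <- w] = w.
Proof. by rewrite /ends -map_comp map_id. Qed.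

Lemma count_after e w L P :
  count P (ends (after e w L)) = count P (ends L) + count_mem e (ends L) * count P w.
Proof.
elim: L => // x L IH; rewrite after_cons /= [ends (_ ++ _)]map_cat count_cat -/(ends _) IH.
rewrite mulnDl; case: eqP => _; rewrite ?mul1n ?mul0n //=; last by rewrite !add0n !addnA.
rewrite ends_pair; lia.
Qed.

Lemma mem_after e w L x : x \in ends L -> x \in ends (after e w L).
Proof. by rewrite -!has_pred1 !has_count count_after => xL; rewrite ltn_addr. Qed.

Lemma perm_after e w L : count_mem e (ends L) = 1 ->
  perm_eq (ends (after e w L)) (w ++ ends L).
Proof. by move=> c1; apply/seq.permP => P; rewrite count_after c1 mul1n count_cat addnC. Qed.

Lemma adj_inserted k e w L : e \in ends L -> k < size w ->
  adj true (nth e (e :: w) k) (nth e w k) (after e w L).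
Proof.
move=> /mem_ends[i /splitPr[L1 L2]] kw; exists i; rewrite after_cat after_cons eqxx /=.
apply: infix_catl; rewrite -cat_cons; apply: infix_catr.
rewrite -[_ :: map _ _]/[seq (i, y) | y <- e :: w] -[[:: _; _]]/[seq (i, y) | y <- [:: _; _]].
apply: infix_map_s; rewrite -[X in infix _ X](cat_take_drop k); apply: infix_catl.
rewrite (drop_nth e) ?ltnS 1?ltnW // -[drop k.+1 _]/(drop k w) (drop_nth e kw).
by apply/infixP; exists [::], (drop k.+1 w).
Qed.

Lemma adj_after_next e w L y : adj true e y L -> adj true (last e w) y (after e w L).
Proof.
case=> i /infixP[L1 [L2 ->]]; exists i; rewrite !after_cat !after_cons eqxx /=.
apply: infix_catl; rewrite -cat_cons; apply: infix_catr; rewrite -cat_cons.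
rewrite -[_ :: map _ _]/[seq (i, z) | z <- e :: w] (lastI e w) map_rcons cat_rcons.
by apply: infix_catl; apply: prefix_infix; rewrite /= !eqxx prefix0s.
Qed.

Lemma adj_after b e w L x y : adj b x y L -> (if b then x else y) != e ->
  adj b x y (after e w L).
Proof.
case=> i xy xe; exists i; case: b xy xe => /infixP[L1 [L2 ->]] /negPf xe;
rewrite !after_cat !after_cons xe /=; apply: infix_catl;
by apply: prefix_infix; rewrite /= !eqxx prefix0s.
Qed.

Lemma valid_insert L L' w : valid L -> balanced w ->
  {in w, forall e, e.1 \notin labels L} -> perm_eq (ends L') (w ++ ends L) -> valid L'.
Proof.
case/andP=> uL bL /andP[uw bw] wL pL; apply/andP; split.
  rewrite (perm_uniq pL) cat_uniq uw uL andbT /=; apply/hasPn => -[a b] eL.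
  by apply: contraL (mem_labels eL) => /wL.
apply/allP => e; rewrite !(perm_mem pL) !mem_cat.
by case/orP => [/(allP bw)->//|/(allP bL)->]; rewrite orbT.
Qed.

Lemma valid_count1 L e : valid L -> e \in ends L -> count_mem e (ends L) = 1.
Proof. by case/andP=> uL _ eL; rewrite count_uniq_mem ?eL. Qed.

Lemma valid_after2 L e1 w1 e2 w2 : valid L -> e1 \in ends L -> e2 \in ends L ->
  balanced (w1 ++ w2) -> {in w1 ++ w2, forall e, e.1 \notin labels L} ->
  valid (after e1 w1 (after e2 w2 L)).
Proof.
move=> vL e1L e2L bw wL; apply: (valid_insert vL bw wL); rewrite -catA.
have e1w : e1 \notin w2.
  apply/negP => e1w; have := wL e1; rewrite mem_cat e1w orbT => /(_ isT)/negP[].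
  by case: (e1) e1L => a b /mem_labels.
apply: (perm_trans (perm_after _ _)).
  by rewrite count_after (count_memPn e1w) muln0 addn0 valid_count1.
by rewrite perm_cat2l perm_after ?valid_count1.
Qed.

Lemma valid_ends L a b : valid L -> a \in labels L -> (a, b) \in ends L.
Proof. by move=> vL aL; rewrite -has_pred1 has_count valid_count. Qed.

Lemma fresh_labels (r : seq nat) : exists p q t,
  [/\ p \notin r, q \notin r, t \notin r & uniq [:: p; q; t]].
Proof.
have lt a : a \in r -> a < (\max_(b <- r) b).+1 by move=> ar; rewrite ltnS leq_bigmax_seq.
pose N := (\max_(b <- r) b).+1; exists N, N.+1, N.+2.
by split; try (apply/negP => /lt); rewrite /N /= ?inE; lia.
Qed.

Lemma del_disjoint A L : {in A, forall a, a \notin labels L} -> del A L = L.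
Proof.
move=> AL; apply/all_filterP/allP => x xL; apply/negP => /AL.
by rewrite (map_f (fun x : letter => x.2.1) xL).
Qed.

Lemma relabel_ext p q L : {in ends L, p =1 q} -> relabel p L = relabel q L.
Proof. by move=> pq; apply/eq_in_map => x xL; rewrite pq // (map_f snd xL). Qed.

Lemma relabel_id p L : {in ends L, p =1 id} -> relabel p L = L.
Proof.
by move=> pq; rewrite (relabel_ext pq) /relabel -[RHS]map_id; apply: eq_map => -[].
Qed.

Lemma relabel_comp p q L : relabel p (relabel q L) = relabel (p \o q) L.
Proof. by rewrite /relabel -map_comp. Qed.

Lemma del_rev A S L : del A (relabel (rev_in S) L) = relabel (rev_in S) (del A L).
Proof. by rewrite /del filter_map. Qed.

Lemma rev_in_inj A : injective (rev_in A).
Proof. exact: inv_inj (rev_inK A). Qed.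

Lemma valid_rev A L : valid L -> valid (relabel (rev_in A) L).
Proof.
case/andP=> uL bL; rewrite /valid ends_relabel /balanced map_inj_uniq ?uL; last exact: rev_in_inj.
apply/allP => _ /mapP[e /(allP bL) eL ->]; apply/mapP; exists (e.1, ~~ e.2) => //.
by rewrite /rev_in /= addbN.
Qed.

Lemma valid_perm L L' : perm_eq (ends L) (ends L') -> valid L -> valid L'.
Proof.
move=> pL vL; apply: (valid_insert (w := [::]) vL) => //; by rewrite perm_sym.
Qed.

Lemma perm_swap x y L : valid L -> x \in ends L -> y \in ends L ->
  perm_eq (ends (relabel (swap x y) L)) (ends L).
Proof.
case/andP=> uL _ xL yL; rewrite ends_relabel.
apply: uniq_perm; rewrite ?(map_inj_uniq (@swap_inj x y)) //.
move=> e; rewrite -[in LHS](swapK x y e) (mem_map (@swap_inj x y)).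
by rewrite /swap; case: eqP => [->|_]; [rewrite xL|case: eqP => [->|//]; rewrite xL].
Qed.

Lemma mem_swap x y L e : valid L -> x \in ends L -> y \in ends L ->
  (e \in ends (relabel (swap x y) L)) = (e \in ends L).
Proof. by move=> vL xL yL; rewrite (perm_mem (perm_swap vL xL yL)). Qed.

Lemma valid_swap x y L : valid L -> x \in ends L -> y \in ends L ->
  valid (relabel (swap x y) L).
Proof. by move=> vL xL yL; apply: (valid_perm _ vL); rewrite perm_sym perm_swap. Qed.

Lemma adj_flip A b a a' c c' L : a \in A -> c \in A -> adj b (a, a') (c, c') L ->
  adj b (a, ~~ a') (c, ~~ c') (relabel (rev_in A) L).
Proof.
by move=> aA cA /(adj_relabel (rev_in A)); rewrite /rev_in /= aA cA.
Qed.

End Insertion.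

(** * Signs *)

Section Signs.
Variable n : nat.
Notation letter := ('I_n * (nat * bool))%type.
Notation word := (seq letter).
Implicit Types (L : word) (s : nat -> bool).

(** Insert a pair p, q of opposite signs inside the parallel pair a, c.  Undoing a
    wBP move on the four arrows gives a and c opposite signs, whereas p and q remain
    parallel with opposite signs.  So R2 deletes first p, q and then a, c. *)
Lemma cls_R2_same s L a c bt bh : valid L -> a != c -> s a = s c ->
  adj bt (a, tail) (c, tail) L -> adj bh (a, head) (c, head) L ->
  cls s L = cls s (del [:: a; c] L).
Proof.
wlog -> : a c bt bh / bt = true => [Hw vL ac sac adjt adjh|].
  case: bt adjt => adjt; first by apply: (Hw a c true bh).
  have -> : del [:: a; c] L = del [:: c; a] L.
    by apply: eq_filter => x; rewrite !inE orbC.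
  by apply: (Hw c a true (~~ bh)) => //; [rewrite eq_sym | exact: adjC].
move=> vL ac sac adjt adjh.
have [p [q [r [pL qL _]]]] := fresh_labels (labels L).
rewrite /= !inE negb_or => /and3P[/andP[pq _] _ _].
have [atL ctL] := adj_ends adjt; have aL := mem_labels atL; have cL := mem_labels ctL.
have neL x y : x \in labels L -> y \notin labels L -> (x == y) = false.
  by move=> xL; apply: contraNF => /eqP<-.
have E := (neL _ _ aL pL, neL _ _ aL qL, neL _ _ cL pL, neL _ _ cL qL, negPf pq, negPf ac).
have {}E := (E, eq_sym p a, eq_sym q a, eq_sym p c, eq_sym q c, eq_sym q p, eq_sym c a).
(* The tails now come in the order a, p, q, c and the heads of p and q are
   adjacent, so that the reversal L0 of L1 is a band-pass configuration. *)
pose L1 := after (c, tail) [:: (p, head); (q, head)] (after (a, tail) [:: (p, tail); (q, tail)] L).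
have vL1 : valid L1.
  apply: valid_after2 => //; first by rewrite /balanced /= !inE !xpair_eqE !E !eqxx.
  by move=> e; rewrite !inE => /or4P[] /eqP->.
have ctL' : (c, tail) \in ends (after (a, tail) [:: (p, tail); (q, tail)] L) by apply: mem_after.
have adj1 : adj true (a, tail) (p, tail) L1.
  by apply: adj_after; [apply: (adj_inserted (k := 0)) | rewrite xpair_eqE !E].
have adj2 : adj true (p, tail) (q, tail) L1.
  by apply: adj_after; [apply: (adj_inserted (k := 1)) | rewrite xpair_eqE !E].
have adj3 : adj true (q, tail) (c, tail) L1.
  by apply: adj_after; [apply: (adj_after_next _ adjt) | rewrite xpair_eqE !E].
have adj4 : adj true (p, head) (q, head) L1 by apply: (adj_inserted (k := 1)).
have adj5 : adj bh (a, head) (c, head) L1.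
  by apply: adj_after; [apply: adj_after => // |]; case: (bh); rewrite xpair_eqE andbF.
have delL1 : del [:: p; q] L1 = L.
  rewrite !del_after ?inE ?E //= !inE !eqxx !orbT /= !after_nil del_disjoint //.
  by move=> z; rewrite !inE => /orP[] /eqP->.
pose S := [:: a; c; p; q].
have [aS cS pS qS] : [/\ a \in S, c \in S, p \in S & q \in S] by rewrite !inE !eqxx !orbT.
pose L0 := relabel (rev_in S) L1.
have vL0 : valid L0 by apply: valid_rev.
(* In s0 the arrows a and c have opposite signs.  Those of p and q, also opposite,
   are chosen to make the four products of the band-pass condition equal. *)
pose s0 z := if z == p then s a == bh else if z == q then s a != bh
             else if z == c then ~~ s a else s z.
pose s1 z := (z == a) (+) ((z \in S) (+) s0 z).
have -> : cls s L = cls s1 L1.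
  rewrite (cls_R2 (a := p) (c := q) (bt := true) (bh := true) (L := L1)) //; first last.
  - by rewrite /s1 /s0 pS qS !E !eqxx /= negbK.
  rewrite delL1; apply: cls_ext => // z zL; rewrite /s1 /s0 !inE (neL z p) // (neL z q) // !orbF.
  case: eqP => [->|_]; first by rewrite E /= negbK.
  by case: eqP => [->|_] //=; rewrite sac negbK.
(* L1 is the result of the move on L0; the arrow a is the one whose sign is
   changed twice. *)
have <- : cls s0 L0 = cls s1 L1.
  have -> : L1 = relabel (rev_in S) L0.
    by rewrite relabel_comp relabel_id // => e _ /=; rewrite rev_inK.
  apply: (@cls_wBP n s0 L0 a c p q bh true true false a (sg (s a) * sg bh)%R) => //.
  - by rewrite /= !inE !E.
  - exact: (adj_flip aS cS adj5).
  - exact: (adj_flip pS qS adj4).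
  - exact: (adj_flip aS pS adj1).
  - exact: (adj_flip cS qS (adjC adj3)).
  - by rewrite /s0 !E !eqxx; split; case: (s a); case: (bh).
rewrite (cls_R2 (a := p) (c := q) (bt := true) (bh := true)) ?pq //; first last.
- exact: (adj_flip pS qS adj2).
- exact: (adj_flip pS qS adj4).
- by rewrite /s0 !E !eqxx negbK.
rewrite del_rev delL1 (cls_R2 (a := a) (c := c) (bt := bh) (bh := true)) //; first last.
- exact: (adj_flip aS cS adjt).
- exact: (adj_flip aS cS adjh).
- by rewrite /s0 !E eqxx negbK.
- exact: valid_rev.
rewrite del_rev relabel_id => [|e].
  apply: cls_ext; first exact: valid_del.
  move=> z; rewrite labels_del mem_filter !inE negb_or => /andP[/andP[za zc] zL].
  by rewrite /s0 (neL z p) // (neL z q) // (negPf zc).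
rewrite ends_del mem_filter !inE negb_or => /andP[/andP[za zc]]; case: e za zc => z b /= za zc.
by move=> /mem_labels zL; rewrite /rev_in !inE /= (neL z p) // (neL z q) // (negPf za) (negPf zc).
Qed.

(** Insert two parallel arrows of the sign opposite to that of a next to a.  One of
    them cancels with a, the other one takes its place. *)
Lemma cls_flip s L a : valid L -> a \in labels L ->
  cls s L = cls (fun z => (z == a) (+) s z) L.
Proof.
move=> vL aL; have [p [q [r [pL qL _]]]] := fresh_labels (labels L).
rewrite /= !inE negb_or => /and3P[/andP[pq _] _ _].
have neL x y : x \in labels L -> y \notin labels L -> (x == y) = false.
  by move=> xL; apply: contraNF => /eqP<-.
have E := (neL _ _ aL pL, neL _ _ aL qL, negPf pq).
have {}E := (E, eq_sym p a, eq_sym q a, eq_sym q p).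
have atL := valid_ends tail vL aL; have ahL := valid_ends head vL aL.
pose ins := fun L => after (a, tail) [:: (p, tail); (q, tail)] (after (a, head) [:: (p, head); (q, head)] L).
have ahL' : (a, tail) \in ends (after (a, head) [:: (p, head); (q, head)] L) by apply: mem_after.
have vL1 : valid (ins L).
  apply: valid_after2 => //; first by rewrite /balanced /= !inE !xpair_eqE !E !eqxx.
  by move=> e; rewrite !inE => /or4P[] /eqP->.
have adjt1 : adj true (a, tail) (p, tail) (ins L) by apply: (adj_inserted (k := 0)).
have adjt2 : adj true (p, tail) (q, tail) (ins L) by apply: (adj_inserted (k := 1)).
have adjh1 : adj true (a, head) (p, head) (ins L).
  by apply: adj_after; [apply: (adj_inserted (k := 0)) | rewrite xpair_eqE andbF].
have adjh2 : adj true (p, head) (q, head) (ins L).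
  by apply: adj_after; [apply: (adj_inserted (k := 1)) | rewrite xpair_eqE andbF].
pose s0 z := if z \in [:: p; q] then ~~ s a else s z.
(* Now p and q can be deleted together, as can a and p; the latter leaves q in
   place of a. *)
have -> : cls s L = cls s0 (ins L).
  rewrite (cls_R2_same (a := p) (c := q) (bt := true) (bh := true) (L := ins L)) ?pq //.
    rewrite !del_after ?inE ?E //= !inE !eqxx !orbT /= !after_nil del_disjoint => [|z].
      by apply: cls_ext => // z zL; rewrite /s0 !inE !(neL z).
    by rewrite !inE => /orP[] /eqP->.
  by rewrite /s0 !inE !eqxx orbT.
rewrite (cls_R2 (a := a) (c := p) (bt := true) (bh := true)) ?E //; last first.
  by rewrite /s0 !inE !eqxx !E negbK.
have renL : rename (fun z => if z == q then a else z) (del [:: a; p] (ins L)) = L.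
  have {vL aL neL atL ahL ahL' vL1 adjt1 adjt2 adjh1 adjh2} ren L' : p \notin labels L' -> q \notin labels L' ->
      rename (fun z => if z == q then a else z) (del [:: a; p] (ins L')) = L'.
    elim: L' => // -[i [z b]] L' IH; rewrite -[labels _]/(z :: labels L') !inE !negb_or.
    move=> /andP[pz /IH IHp] /andP[qz /IHp {}IHL].
    rewrite /ins (after_cons _ _ (i, (z, b))) -cat_cons after_cat -/(ins L') del_cat.
    rewrite /rename /relabel map_cat [X in _ ++ X]IHL -[RHS]cat1s.
    congr cat; have [->|za] := eqVneq z a.
      case: b; rewrite !xpair_eqE !eqxx !after_cons !xpair_eqE !eqxx ?E /=;
      by rewrite !inE !eqxx !E /= eqxx.
    by rewrite !xpair_eqE (negPf za) after_cons xpair_eqE (negPf za) /= !inE (negPf za)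
      (eq_sym z) (negPf pz) /= (eq_sym z) (negPf qz).
  exact: ren.
rewrite -[X in _ = cls _ X]renL; apply: cls_rename; first exact: valid_del.
  move=> x y; rewrite !labels_del !mem_filter !inE !negb_or.
  move=> /andP[/andP[xa _] _] /andP[/andP[ya _] _].
  by case: eqP => [->|_]; case: eqP => [->|_] // e; [rewrite e eqxx in ya | rewrite e eqxx in xa].
move=> x; rewrite labels_del mem_filter !inE negb_or => /andP[/andP[xa xp] _].
rewrite /s0 !inE (negPf xp) /=; case: ifP => _; first by rewrite eqxx.
by rewrite (negPf xa).
Qed.

Lemma cls_sign s s' L : valid L -> cls s L = cls s' L.
Proof.
move=> vL.
(* r contains the labels at which the signs still have to be changed. *)
suff gen (r : seq nat) s1 : {subset r <= labels L} ->
    (forall a, a \in labels L -> s1 a != s' a -> a \in r) -> cls s1 L = cls s' L.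
  by apply: (gen (labels L)) => a aL.
elim: r s1 => [|a r IH] {}s rL sr.
  by apply: cls_ext => // a aL; apply/eqP/negPn/negP => /(sr a aL).
have [aL rL'] : a \in labels L /\ {subset r <= labels L}.
  by split=> [|b br]; apply: rL; rewrite inE ?eqxx ?br ?orbT.
have [sa|sa] := eqVneq (s a) (s' a).
  apply: IH => // b bL sb; have := sr b bL sb; rewrite inE => /orP[/eqP ba|//].
  by rewrite ba sa eqxx in sb.
rewrite (cls_flip s vL aL); apply: IH => // b bL.
have [->|ba] := eqVneq b a; first by case: (s a) (s' a) sa => -[].
by move=> sb; have := sr b bL sb; rewrite inE (negPf ba).
Qed.

End Signs.

(** * Moves without signs *)

Section MovesWithoutSigns.
Variable n : nat.
Notation letter := ('I_n * (nat * bool))%type.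
Notation word := (seq letter).
Implicit Types (L : word).

(** By [cls_sign] any other choice of the signs gives the same class. *)
Definition ucls L := cls (fun=> true) L.

Lemma ucls_R1 L a b : valid L -> adj b (a, tail) (a, head) L ->
  ucls L = ucls (del [:: a] L).
Proof. exact: cls_R1. Qed.

Lemma ucls_R2 L a c bt bh : valid L -> a != c ->
  adj bt (a, tail) (c, tail) L -> adj bh (a, head) (c, head) L ->
  ucls L = ucls (del [:: a; c] L).
Proof. by move=> vL ac; apply: cls_R2_same. Qed.

Lemma ucls_OC L a c b : valid L -> adj b (a, tail) (c, tail) L ->
  ucls L = ucls (relabel (swap (a, tail) (c, tail)) L).
Proof. exact: cls_OC. Qed.

(** Once b1, b2, b3 are given, there are signs that satisfy the condition of R3. *)
Lemma ucls_R3 L a12 a23 a13 b1 b2 b3 : valid L -> uniq [:: a12; a23; a13] ->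
  adj b1 (a13, tail) (a12, tail) L -> adj b2 (a12, head) (a23, tail) L ->
  adj b3 (a23, head) (a13, head) L ->
  ucls L = ucls (relabel (fun e => swap (a23, head) (a13, head)
    (swap (a12, head) (a23, tail) (swap (a13, tail) (a12, tail) e))) L).
Proof.
move=> vL u adj1 adj2 adj3.
have [a12L a23L] := adj_ends adj2; have [a13L _] := adj_ends adj1.
have [_ a13L'] := adj_ends adj3; have [a23L' _] := adj_ends adj3.
have [_ a12L'] := adj_ends adj1.
pose s z := if z == a12 then b1 == b2 else if z == a23 then b2 == b3 else b1 != b3.
have := u; rewrite /= !inE negb_or => /and3P[/andP[n1 n2] n3 _].
rewrite /ucls (cls_sign _ s vL) (cls_R3 vL u adj1 adj2 adj3).
- apply: cls_sign.
  have v1 := valid_swap vL a13L a12L'.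
  have v2 : valid (relabel (swap (a12, head) (a23, tail)) (relabel (swap (a13, tail) (a12, tail)) L)).
    by apply: valid_swap; rewrite ?mem_swap.
  rewrite -[relabel _ _]/(relabel (swap (a23, head) (a13, head) \o
    (swap (a12, head) (a23, tail) \o swap (a13, tail) (a12, tail))) L) -!relabel_comp.
  by apply: valid_swap; rewrite ?mem_swap.
- by rewrite /s !eqxx (eq_sym a23) (negPf n1); case: b1 b2 b3 {adj1 adj2 adj3 s} => [] [] [].
- rewrite /s !eqxx (eq_sym a23) (negPf n1) !(eq_sym a13) (negPf n2) (negPf n3).
  by case: b1 b2 b3 {adj1 adj2 adj3 s} => [] [] [].
Qed.

(** Again the signs can be chosen so that the band-pass condition holds, whatever the
    orders on the four portions are. *)
Lemma ucls_BP L a13 a14 a23 a24 b1 b2 b3 b4 (S := [:: a13; a14; a23; a24]) :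
  valid L -> uniq S ->
  adj b1 (a13, tail) (a14, tail) L -> adj b2 (a23, tail) (a24, tail) L ->
  adj b3 (a13, head) (a23, head) L -> adj b4 (a14, head) (a24, head) L ->
  ucls L = ucls (relabel (rev_in S) L).
Proof.
move=> vL u adj1 adj2 adj3 adj4.
pose s z := if z == a13 then b1 == b3 else if z == a14 then b1 == b4 else
            if z == a23 then b2 == b3 else b2 == b4.
have := u; rewrite /= !inE !negb_or => /and4P[/and3P[n1 n2 n3] /andP[n4 n5] n6 _].
rewrite /ucls (cls_sign _ s vL) (@cls_wBP n s L _ _ _ _ _ _ _ _ a13 1%R vL u _ adj1 adj2 adj3 adj4).
- by apply: cls_sign; apply: valid_rev.
- by rewrite inE eqxx.
rewrite /s !eqxx (eq_sym a14 a13) !(eq_sym a23 a13, eq_sym a23 a14) !(eq_sym a24).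
rewrite (negPf n1) (negPf n2) (negPf n3) (negPf n4) (negPf n5) (negPf n6).
by split; case: b1 b2 b3 b4 {adj1 adj2 adj3 adj4 s} => [] [] [] [].
Qed.

End MovesWithoutSigns.

(** * Endpoints commute *)

Section Commutation.
Variable n : nat.
Notation letter := ('I_n * (nat * bool))%type.
Notation word := (seq letter).
Implicit Types (L : word).

Lemma swap_conj (r : nat * bool -> nat * bool) x y e : injective r ->
  r (swap x y e) = swap (r x) (r y) (r e).
Proof. by move=> r_inj; rewrite /swap !(inj_eq r_inj) !(fun_if r). Qed.

Lemma adj_swap b x y L : adj b x y L -> adj b y x (relabel (swap x y) L).
Proof. by move/(adj_relabel (swap x y)); rewrite swapl swapr. Qed.

Lemma adj_swapN b x y z t L : z != x -> z != y -> t != x -> t != y ->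
  adj b z t L -> adj b z t (relabel (swap x y) L).
Proof. by move=> zx zy tx ty /(adj_relabel (swap x y)); rewrite !swapN. Qed.

(** Conjugate OC by a band-pass: the heads of a and c become tails, which commute. *)
Lemma ucls_BP_swap L a c p q b1 b2 b3 b4 : valid L -> uniq [:: a; p; c; q] ->
  adj b1 (a, tail) (p, tail) L -> adj b2 (c, tail) (q, tail) L ->
  adj b3 (a, head) (c, head) L -> adj b4 (p, head) (q, head) L ->
  ucls L = ucls (relabel (swap (a, head) (c, head)) L).
Proof.
move=> vL u adj1 adj2 adj3 adj4; rewrite (ucls_BP vL u adj1 adj2 adj3 adj4).
set S := [:: a; p; c; q]; set L1 := relabel _ L; have vL1 : valid L1 by apply: valid_rev.
have [aS pS cS qS] : [/\ a \in S, p \in S, c \in S & q \in S] by rewrite !inE !eqxx !orbT.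
have adj3' := adj_flip aS cS adj3; have adj4' := adj_flip pS qS adj4.
have adj1' := adj_flip aS pS adj1; have adj2' := adj_flip cS qS adj2.
(* The same four arrows are again a band-pass configuration, in which the two
   portions with tails and the two with heads have changed roles. *)
rewrite (ucls_OC vL1 adj3'); set L2 := relabel _ L1.
have vL2 : valid L2 by case: (adj_ends adj3') => aL1 cL1; apply: valid_swap.
have := u; rewrite /= !inE !negb_or => /and4P[/and3P[n1 n2 n3] /andP[n4 n5] n6 _].
rewrite (@ucls_BP n L2 a c p q (~~ b3) b4 b1 b2) //.
- rewrite !relabel_comp; congr ucls; apply: relabel_ext => e _ /=.
  have -> : rev_in [:: a; c; p; q] =1 rev_in S.
    by move=> z; rewrite /rev_in !inE; congr (_, (_ || _) (+) _); rewrite orbCA.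
  rewrite (swap_conj _ _ _ (@rev_in_inj S)) rev_inK.
  by rewrite /rev_in /= aS cS.
- by rewrite /= !inE !negb_or n1 n2 n3 n5 n6 eq_sym n4.
- exact: (adjC (adj_swap adj3')).
- by apply: adj_swapN adj4' => //; rewrite xpair_eqE /= ?andbT // eq_sym.
- by apply: adj_swapN adj1'; rewrite xpair_eqE andbF.
- by apply: adj_swapN adj2'; rewrite xpair_eqE andbF.
Qed.

(** It suffices to complete a and c to the configuration of [ucls_BP_swap] by arrows
    that can be deleted before as well as after the exchange. *)
Lemma ucls_HC L a c b : valid L -> a != c -> adj b (a, head) (c, head) L ->
  ucls L = ucls (relabel (swap (a, head) (c, head)) L).
Proof.
move=> vL ac adjL; have [p [q [r [pL qL rL]]]] := fresh_labels (labels L).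
rewrite /= !inE !negb_or => /and3P[/andP[pq pr] qr _].
have [ahL chL] := adj_ends adjL; have aL := mem_labels ahL; have cL := mem_labels chL.
have neL x y : x \in labels L -> y \notin labels L -> (x == y) = false.
  by move=> xL; apply: contraNF => /eqP<-.
have E := (neL _ _ aL pL, neL _ _ aL qL, neL _ _ aL rL, neL _ _ cL pL, neL _ _ cL qL, neL _ _ cL rL).
have {}E := (E, negPf pq, negPf pr, negPf qr, negPf ac).
have {}E := (E, eq_sym p a, eq_sym q a, eq_sym r a, eq_sym p c, eq_sym q c, eq_sym r c).
have {}E := (E, eq_sym q p, eq_sym r p, eq_sym r q, eq_sym c a).
(* An isolated arrow p provides a tail next to that of a.  Arrow q, running from the
   tail of c to the head of p, is the fourth arrow of the configuration, and r makes
   its insertion an R2 move. *)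
pose ins L := after (a, tail) [:: (p, tail); (p, head); (q, head); (r, head)]
                (after (c, tail) [:: (q, tail); (r, tail)] L).
have insP L' : valid L' -> labels L' =i labels L -> valid (ins L') /\ ucls (ins L') = ucls L'.
  move=> vL' eL'; have atL' : (a, tail) \in ends L' by apply: valid_ends; rewrite ?eL'.
  have ctL' : (c, tail) \in ends L' by apply: valid_ends; rewrite ?eL'.
  have vi : valid (ins L').
    apply: valid_after2 => //; first by rewrite /balanced /= !inE !xpair_eqE !E !eqxx.
    by apply/allP; rewrite /= !eL' pL qL rL.
  split=> //.
  have atL2 : (a, tail) \in ends (after (c, tail) [:: (q, tail); (r, tail)] L') by apply: mem_after.
  have di : del [:: q; r] (ins L') = after (a, tail) [:: (p, tail); (p, head)] L'.
    rewrite !del_after ?inE ?E //= !inE !eqxx !orbT !E /= after_nil del_disjoint //.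
    by apply/allP; rewrite /= !eL' qL rL.
  rewrite (@ucls_R2 n (ins L') q r true true) //; last 2 first.
  - apply: adj_after; last by rewrite xpair_eqE !E.
    by apply: (adj_inserted (k := 1)).
  - by apply: (adj_inserted (k := 3)).
  rewrite di (@ucls_R1 n _ p true); last 2 first.
  - by rewrite -di; apply: valid_del.
  - by apply: (adj_inserted (k := 1)).
  rewrite del_after ?inE ?E //= !inE !eqxx /= after_nil del_disjoint //.
  by apply/allP; rewrite /= !eL' pL.
have [vi ei] := insP L vL (fun=> erefl).
have vs : valid (relabel (swap (a, head) (c, head)) L) by apply: valid_swap.
have ls : labels (relabel (swap (a, head) (c, head)) L) =i labels L.
  by move=> z; rewrite !labels_ends; apply/perm_mem/perm_map/perm_swap.
have [_ ei'] := insP _ vs ls.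
have ctL := valid_ends tail vL cL; have atL := valid_ends tail vL aL.
rewrite -ei -ei' (@ucls_BP_swap (ins L) a c p q true true b true) //.
- congr ucls; rewrite /ins !relabel_after; try exact: swap_inj.
  by rewrite /= !swapN // ?xpair_eqE ?andbF ?E.
- by rewrite /= !inE !E.
- by apply: (adj_inserted (k := 0)); first exact: mem_after.
- apply: adj_after; last by rewrite xpair_eqE !E.
  by apply: (adj_inserted (k := 0)).
- by apply: adj_after; [apply: adj_after => // |]; case: (b); rewrite xpair_eqE andbF.
- by apply: (adj_inserted (k := 2)); first exact: mem_after.
Qed.

(** An auxiliary arrow p from the tail of a to the head of c makes an R3
    configuration with a and c. *)
Lemma ucls_HT L a c b : valid L -> a != c -> adj b (a, head) (c, tail) L ->
  ucls L = ucls (relabel (swap (a, head) (c, tail)) L).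
Proof.
move=> vL ac adjL; have [p [q [r [pL qL _]]]] := fresh_labels (labels L).
rewrite /= !inE !negb_or => /and3P[/andP[pq _] _ _].
have [ahL ctL] := adj_ends adjL; have aL := mem_labels ahL; have cL := mem_labels ctL.
have neL x y : x \in labels L -> y \notin labels L -> (x == y) = false.
  by move=> xL; apply: contraNF => /eqP<-.
have E := (neL _ _ aL pL, neL _ _ aL qL, neL _ _ cL pL, neL _ _ cL qL, negPf pq, negPf ac).
have {}E := (E, eq_sym p a, eq_sym q a, eq_sym p c, eq_sym q c, eq_sym q p, eq_sym c a).
(* R3 involves a, c and the new arrow p; the arrow q makes the insertion of p an R2
   move. *)
pose ins L := after (a, tail) [:: (p, tail); (q, tail)]
                (after (c, head) [:: (p, head); (q, head)] L).
have insP L' : valid L' -> labels L' =i labels L -> valid (ins L') /\ ucls (ins L') = ucls L'.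
  move=> vL' eL'; have atL' : (a, tail) \in ends L' by apply: valid_ends; rewrite ?eL'.
  have chL' : (c, head) \in ends L' by apply: valid_ends; rewrite ?eL'.
  have vi : valid (ins L').
    apply: valid_after2 => //; first by rewrite /balanced /= !inE !xpair_eqE !E !eqxx.
    by apply/allP; rewrite /= !eL' pL qL.
  split=> //; rewrite (@ucls_R2 n (ins L') p q true true) //; last 2 first.
  - by apply: (adj_inserted (k := 1)); first exact: mem_after.
  - by apply: adj_after; [apply: (adj_inserted (k := 1)) | rewrite xpair_eqE andbF].
  rewrite !del_after ?inE ?E //= !inE !eqxx !orbT /= !after_nil del_disjoint //.
  by apply/allP; rewrite /= !eL' pL qL.
have [vi ei] := insP L vL (fun=> erefl).
have vs : valid (relabel (swap (a, head) (c, tail)) L) by apply: valid_swap.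
have ls : labels (relabel (swap (a, head) (c, tail)) L) =i labels L.
  by move=> z; rewrite !labels_ends; apply/perm_mem/perm_map/perm_swap.
have [_ ei'] := insP _ vs ls.
have chL := valid_ends head vL cL; have atL := valid_ends tail vL aL.
have adj1 : adj false (p, tail) (a, tail) (ins L).
  by apply: (@adjC _ true); apply: (adj_inserted (k := 0)); first exact: mem_after.
have adj2 : adj b (a, head) (c, tail) (ins L).
  by apply: adj_after; [apply: adj_after => // |]; case: (b); rewrite xpair_eqE ?andbF ?E.
have adj3 : adj true (c, head) (p, head) (ins L).
  by apply: adj_after; [apply: (adj_inserted (k := 0)) | rewrite xpair_eqE andbF].
have u : uniq [:: a; c; p] by rewrite /= !inE !E.
rewrite -ei -ei' (ucls_R3 vi u adj1 adj2 adj3).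
(* Besides s2, R3 performs the exchanges s1 of two tails and s3 of two heads, which
   are undone separately. *)
set s1 := swap (p, tail) _; set s2 := swap (a, head) _; set s3 := swap (c, head) _.
have s1N z : z.1 != p -> z.1 != a \/ z.2 = head -> s1 z = z.
  case: z => z d /= zp za; apply: swapN; rewrite xpair_eqE ?(negPf zp) //.
  by case: za => [/negPf->|->] //; rewrite andbF.
have s12 e : s1 (s2 e) = s2 (s1 e).
  rewrite /s2 (swap_conj _ _ _ (@swap_inj _ _ : injective s1)).
  by rewrite (s1N (a, head) _ (or_intror erefl)) ?E // (s1N (c, tail)) ?E //; left.
have s13 e : s1 (s3 e) = s3 (s1 e).
  rewrite /s3 (swap_conj _ _ _ (@swap_inj _ _ : injective s1)).
  have -> : s1 (p, head) = (p, head) by rewrite /s1 swapN ?xpair_eqE ?andbF.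
  by rewrite (s1N (c, head) _ (or_intror erefl)) ?E.
have [ptL1 atL1] := adj_ends adj1; have [ahL1 ctL1] := adj_ends adj2.
have [chL1 phL1] := adj_ends adj3.
pose L1 := relabel s3 (relabel s2 (relabel s1 (ins L))).
have v1 : valid (relabel s1 (ins L)) by apply: valid_swap.
have v2 : valid (relabel s2 (relabel s1 (ins L))) by apply: valid_swap; rewrite ?mem_swap.
have v3 : valid L1 by apply: valid_swap; rewrite ?mem_swap.
rewrite -[relabel _ _]/(relabel (s3 \o (s2 \o s1)) (ins L)) -!relabel_comp -/L1.
have adj1' : adj false (a, tail) (p, tail) L1.
  by do 2!(apply: adj_swapN; rewrite ?xpair_eqE ?andbF ?E //); apply: adj_swap.
have adj3' : adj true (p, head) (c, head) L1.
  by apply: adj_swap; do 2!(apply: adj_swapN; rewrite ?xpair_eqE ?andbF ?E //).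
rewrite (ucls_OC v3 (adjC adj1')) -/s1.
have v4 : valid (relabel s1 L1) by apply: valid_swap; rewrite ?mem_swap.
rewrite (@ucls_HC (relabel s1 L1) c p false) ?E //; last first.
  by apply: (@adjC _ true); apply: adj_swapN; rewrite ?xpair_eqE ?andbF ?E.
rewrite !relabel_comp -/s3; congr ucls.
have -> : ins (relabel s2 L) = relabel s2 (ins L).
  rewrite /ins !relabel_after; try exact: swap_inj.
  by rewrite /= /s2 !(@swapN (a, head)) ?xpair_eqE ?andbF ?E.
apply: relabel_ext => e _ /=; rewrite s13 s12.
by rewrite [s1 (s1 _)]swapK [s3 (s3 _)]swapK.
Qed.

(** When both are endpoints of the same arrow, this arrow can be removed by R1 and put
    back in the opposite direction. *)
Lemma ucls_swap_ends L x y b : valid L -> x != y -> adj b x y L ->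
  ucls L = ucls (relabel (swap x y) L).
Proof.
move=> vL xy adjL; have [xL yL] := adj_ends adjL.
case: x y xy adjL xL yL => a b1 [c b2]; have [<-|ac _] := eqVneq a c.
  rewrite xpair_eqE eqxx /= => b12 adjL xL yL.
  have R1 L' (d : bool) : valid L' -> adj d (a, b1) (a, b2) L' -> ucls L' = ucls (del [:: a] L').
    case: b1 b2 b12 {adjL xL yL} => [] [] // _ vL' adjL'; last exact: ucls_R1 adjL'.
    exact: ucls_R1 (adjC adjL').
  rewrite (R1 _ _ vL adjL) (R1 (relabel _ L) (~~ b)).
  - congr ucls; rewrite /del /relabel filter_map -[LHS]map_id.
    rewrite [in RHS](eq_filter (a2 := fun z : letter => z.2.1 \notin [:: a])) => [|[i e] /=].
      apply/eq_in_map => -[i [d d']]; rewrite mem_filter inE /= => /andP[da _].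
      by rewrite swapN ?xpair_eqE ?(negPf da).
    by rewrite /swap; case: eqP => [->|_] //; case: eqP => [->|_].
  - exact: valid_swap.
  - exact: (adjC (adj_swap adjL)).
move=> adjL xL yL; case: b1 b2 adjL {xL yL} => [] [] adjL.
- exact: ucls_HC adjL.
- exact: ucls_HT adjL.
- have -> : relabel (swap (a, tail) (c, head)) L = relabel (swap (c, head) (a, tail)) L.
    apply: relabel_ext => e _; rewrite /swap; case: eqP => [->|_] //.
    by rewrite xpair_eqE andbF.
  by apply: ucls_HT (adjC adjL); rewrite // eq_sym.
- exact: ucls_OC adjL.
Qed.

Lemma ucls_swap L1 x y L2 : valid (L1 ++ x :: y :: L2) ->
  ucls (L1 ++ x :: y :: L2) = ucls (L1 ++ y :: x :: L2).
Proof.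
move=> vL; have [xy|xy] := eqVneq x.1 y.1; last first.
  apply: cls_strands => // i; rewrite !on_strand_cat /on_strand /=; congr cat.
  have [xi|] := eqVneq x.1 i; have [yi|] := eqVneq y.1 i => //.
  by rewrite xi yi eqxx in xy.
case: x y xy vL => i x [j y] /= <- vL.
have /andP[+ _] := vL; rewrite /ends map_cat /= cat_uniq /= !inE !negb_or.
case/and5P=> _ /and3P[x1 y1 _] /andP[xy x2] y2 _.
rewrite (@ucls_swap_ends _ x y true) //; last first.
  by exists i; apply: infix_catl; apply: prefix_infix; rewrite /= !eqxx prefix0s.
have fix_ends L : x \notin ends L -> y \notin ends L -> relabel (swap x y) L = L.
  move=> xL yL; apply: relabel_id => e eL.
  by rewrite swapN //; [apply: contraNneq xL => <- | apply: contraNneq yL => <-].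
by rewrite /relabel map_cat /= swapl swapr -!/(relabel _ _) !fix_ends.
Qed.

Lemma valid_perm_word L L' : perm_eq L L' -> valid L -> valid L'.
Proof. by move=> pL; apply/valid_perm/perm_map. Qed.

Lemma ucls_move L0 x L1 L2 : valid (L0 ++ x :: L1 ++ L2) ->
  ucls (L0 ++ x :: L1 ++ L2) = ucls (L0 ++ L1 ++ x :: L2).
Proof.
elim: L1 L0 => //= y L1 IH L0 vL; rewrite ucls_swap // -cat_rcons IH ?cat_rcons //.
by apply: valid_perm_word vL; rewrite perm_cat2l -!(cat1s _ (_ :: _)) -!(cat1s _ (_ ++ _)) perm_catCA.
Qed.

(** Thus a diagram is determined by the strands of the tail and of the head of each
    of its arrows. *)
Lemma ucls_perm L L' : valid L -> perm_eq L L' -> ucls L = ucls L'.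
Proof.
(* The letters are put in their final place one by one; L0 is the finished part. *)
suff gen L0 : valid (L0 ++ L) -> perm_eq L L' -> ucls (L0 ++ L) = ucls (L0 ++ L').
  exact: (gen [::]).
elim: L L0 L' => [|x L IH] L0 L' vL pL.
  by rewrite perm_sym in pL; rewrite (perm_nilP pL).
have /splitPr eL' : x \in L' by rewrite -(perm_mem pL) mem_head.
case: eL' pL => L1 L2; rewrite perm_sym perm_catC /= perm_cons perm_catC perm_sym => pL.
rewrite -ucls_move; first by rewrite -!(cat_rcons x L0); apply: IH; rewrite // cat_rcons.
by apply: valid_perm_word vL; rewrite perm_cat2l perm_cons.
Qed.

End Commutation.

(** * Invariance of the parities *)

Section Invariance.
Variable n : nat.
Implicit Types D E : gauss n.
Local Open Scope ring_scope.

Lemma strand_ofP D : exists st : endpoint D -> 'I_n,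
  forall e i, (e \in strand D i) = (i == st e).
Proof.
apply: (fin_all_exists (P := fun (e : endpoint D) k => forall i, (e \in strand D i) = (i == k))).
move=> e; have := gauss_once e.
have [k ke|none] := pickP (fun k => e \in strand D k); last first.
  by rewrite big1 // => i _; apply/count_memPn; rewrite none.
rewrite (bigD1 k) //= => s1; exists k => i; have [->//|ik] := eqVneq i k.
have k1 : (0 < count_mem e (strand D k))%N by rewrite -has_count has_pred1.
apply/negbTE; rewrite -has_pred1 has_count -leqNgt leqn0.
have := s1; rewrite (bigD1 i) //=; case: (count_mem e (strand D k)) k1 => // m _ /eqP.
by rewrite addSn eqSS !addn_eq0 => /and3P[].
Qed.

Lemma adjacent_mem D b (x y : endpoint D) i :
  adjacent b x y -> (x \in strand D i) = (y \in strand D i).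
Proof.
have [st stE] := strand_ofP D; case=> k /mem_infix xy; rewrite !stE.
have xk : x \in strand D k by apply: xy; case: (b); rewrite !inE eqxx ?orbT.
have yk : y \in strand D k by apply: xy; case: (b); rewrite !inE eqxx ?orbT.
by move: xk yk; rewrite !stE => /eqP<- /eqP<-.
Qed.

Lemma wBP_inv_vlk D D' : (forall i j, i != j -> vlk D i j = vlk D' i j) ->
  wBP_inv D = wBP_inv D'.
Proof.
move=> e; congr (_, _); apply/ffunP; [case=> [[i j] ij]|move=> i]; rewrite !ffunE /=.
  have nij : i != j by apply: contraTneq ij => /= ->; rewrite ltnn.
  by rewrite /vlk_mod !e // eq_sym.
by congr _%:~R; apply: eq_bigr => k ki; rewrite e // eq_sym.
Qed.

Lemma vlk_deletion D (S : {set arrow D}) D' i j : deletion S D' ->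
  vlk D i j = vlk D' i j +
    \sum_(a in S | ((a, tail) \in strand D i) && ((a, head) \in strand D j)) eps a.
Proof.
case=> f [f_inj fS fs fL]; rewrite /vlk (bigID (mem S)) /= addrC; congr (_ + _); last first.
  by apply: eq_bigl => a; rewrite andbC.
have mem a b k : ((f a, b) \in strand D k) = ((a, b) \in strand D' k).
  have <- : ((f a, b) \in [seq e <- strand D k | e.1 \notin S]) = ((f a, b) \in strand D k).
    by rewrite mem_filter /= -fS codom_f.
  by rewrite -fL (mem_map (end_map_inj f_inj) _ (a, b)).
rewrite (eq_bigl (fun a => (a \in f @: [set: arrow D']) &&
    (((a, tail) \in strand D i) && ((a, head) \in strand D j)))); last first.
  move=> a; rewrite andbC -fS; congr (_ && _); apply/codomP/imsetP => [[x ->]|[x _ ->]]; by exists x.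
rewrite big_mkcondr big_imset => [|? ? _ _ /f_inj//]; rewrite -big_mkcondr /=.
by apply: eq_big => [a|a _]; rewrite ?inE ?mem // /eps fs.
Qed.

Lemma vlk_permute D (p : {perm endpoint D}) i j :
  (forall e k, (p e \in strand D k) = (e \in strand D k)) ->
  vlk (permute_ends p) i j = vlk D i j.
Proof.
move=> pm; have mem e k : (e \in strand (permute_ends p) k) = (e \in strand D k).
  by rewrite ffunE -{1}(permKV p e) (mem_map (@perm_inj _ p)) -pm permKV.
by apply: eq_bigl => a; rewrite !mem.
Qed.

Lemma mem_tperm D b (x y e : endpoint D) k : adjacent b x y ->
  (tperm x y e \in strand D k) = (e \in strand D k).
Proof. by move=> /adjacent_mem xy; case: tpermP => // ->. Qed.

Lemma wBP_inv_iso D D' : diagram_iso D D' -> wBP_inv D = wBP_inv D'.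
Proof.
move=> iso; apply: wBP_inv_vlk => i j _; rewrite (vlk_deletion i j iso) big_pred0 ?addr0 //.
by move=> a; rewrite inE.
Qed.

Lemma wBP_inv_welded D D' : welded_move D D' -> wBP_inv D = wBP_inv D'.
Proof.
move=> m; apply: wBP_inv_vlk => i j ij; case: m.
- case=> a [b [adj del]]; rewrite (vlk_deletion i j del) big_pred0 ?addr0 // => c.
  rewrite inE; case: eqP => //= ->; rewrite (adjacent_mem i adj).
  have [st stE] := strand_ofP D; rewrite !stE; case: eqP => // <-; rewrite andTb.
  by apply/negbTE; rewrite eq_sym.
- case=> a1 [a2 [bt [bh [ne s12 adjt adjh del]]]]; rewrite (vlk_deletion i j del).
  rewrite big_mkcondr big_setU1 ?inE //= big_set1 (adjacent_mem i adjt) (adjacent_mem j adjh).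
  by rewrite /eps s12; case: ifP => _; rewrite ?addr0 //; case: (sgn D a2); rewrite ?addrN ?addNr addr0.
- case=> a12 [a23 [a13 [b1 [b2 [b3 [_ [adj1 adj2 adj3] _ _ ->]]]]]].
  rewrite vlk_permute // => e k.
  by rewrite !permM (mem_tperm _ _ adj3) (mem_tperm _ _ adj2) (mem_tperm _ _ adj1).
- case=> a1 [a2 [b [adj ->]]]; rewrite vlk_permute // => e k.
  exact: (mem_tperm _ _ adj).
Qed.

Lemma sg_mod2 b : (sg b)%:~R = 1 :> 'Z_2.
Proof. by case: b; apply/eqP. Qed.

(** Modulo 2 all signs are 1. *)
Lemma vlk_modE D i j : vlk_mod D i j =
  \sum_(a : arrow D) (((a, tail) \in strand D i) && ((a, head) \in strand D j))%:R.
Proof.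
rewrite /vlk_mod /vlk rmorph_sum big_mkcond /=; apply: eq_bigr => a _.
by case: ifP => _; rewrite -?[eps a]/(sg _) ?sg_mod2.
Qed.

Lemma vlk_star_modE D i : vlk_star_mod D i =
  \sum_(a : arrow D) (((a, tail) \in strand D i) && ((a, head) \notin strand D i))%:R.
Proof.
rewrite /vlk_star_mod rmorph_sum /=.
rewrite (eq_bigr (fun k => \sum_(a : arrow D)
    (((a, tail) \in strand D i) && ((a, head) \in strand D k))%:R)); last first.
  by move=> k _; rewrite -vlk_modE.
rewrite exchange_big; apply: eq_bigr => a _; have [st stE] := strand_ofP D.
rewrite !stE; have [hi|hi] := eqVneq i (st (a, head)).
  by rewrite andbF big1 // => k ki; rewrite stE -hi (negPf ki) andbF.
rewrite (bigD1 (st (a, head))) 1?eq_sym //= stE eqxx big1 ?addr0 // => k /andP[_ /negPf hk].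
by rewrite stE hk andbF.
Qed.

Lemma addbb2 (x : 'Z_2) : x + x = 0.
Proof. by case: x => -[|[|[]]] // ?; apply: val_inj. Qed.

Lemma wBP_inv_wBP D D' : wBP D D' -> wBP_inv D = wBP_inv D'.
Proof.
case=> a13 [a14 [a23 [a24 [[b1 [b2 [b3 [b4 [u [adj1 adj2] [adj3 adj4] _]]]]] [a _ ->]]]]].
set S := [set a13; a14; a23; a24]; set D1 := SR_result _.
have memE x b k : ((x, b) \in strand D1 k) = ((x, (x \in S) (+) b) \in strand D k).
  rewrite /= ffunE; apply/mapP/idP => [[[y c] yc]|xb].
    by rewrite permE => -[-> ->]; rewrite addKb.
  by exists (x, (x \in S) (+) b); rewrite // permE /reverse_ends /= addKb.
congr (_, _); apply/ffunP; [case=> [[i j] ij]|move=> i0]; rewrite !ffunE /=.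
  rewrite !vlk_modE -!big_split; apply: eq_bigr => x _ /=; rewrite !memE.
  by case: (x \in S) => //=; rewrite addrC; congr (_%:R + _%:R); rewrite andbC.
set i := widen_ord _ _; rewrite !vlk_star_modE.
(* Arrows leaving strand i are those with tail on i, minus those with both ends on
   i; a reversal does not change the latter. *)
have parity (x y : bool) : (x && ~~ y)%:R = x%:R + (x && y)%:R :> 'Z_2.
  by case: x y => [] []; rewrite /= ?addr0 ?addbb2.
rewrite (eq_bigr _ (fun x _ => parity _ _)) [RHS](eq_bigr _ (fun x _ => parity _ _)).
rewrite !big_split /=; congr (_ + _); last first.
  by apply: eq_bigr => x _; rewrite !memE; case: (x \in S) => //=; rewrite andbC.
rewrite [LHS](bigID (mem S)) [RHS](bigID (mem S)) /=; congr (_ + _); last first.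
  by apply: eq_bigr => x /negPf xS; rewrite memE xS.
rewrite [RHS](eq_bigr (fun x : arrow D => ((x, head) \in strand D i)%:R)); last first.
  by move=> x xS; rewrite memE xS.
have S_sum (F : arrow D -> 'Z_2) : \sum_(x in S) F x = F a13 + F a14 + F a23 + F a24.
  have -> : \sum_(x in S) F x = \sum_(x <- [:: a13; a14; a23; a24]) F x.
    by rewrite big_uniq //=; apply: eq_bigl => x; rewrite !inE -!orbA.
  by rewrite !big_cons big_nil addr0 !addrA.
rewrite !S_sum (adjacent_mem i adj1) (adjacent_mem i adj2).
rewrite (adjacent_mem i adj3) (adjacent_mem i adj4) addbb2 add0r addbb2.
by rewrite -addrA addbb2.
Qed.

Lemma vlk_stack D E i j : vlk (stack D E) i j = vlk D i j + vlk E i j.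
Proof.
rewrite /vlk big_split_ord /=; congr (_ + _).
- apply: eq_big => [a|a _]; last exact: eps_stackr.
  rewrite !ffunE !mem_cat -!/(lend _ (_, _)) !(mem_map (@lend_inj _ _)).
  have no b k : (lend (narr E) (a, b) \in [seq rend (narr D) e | e <- strand E k]) = false.
    by apply/mapP => -[e _ /eqP]; rewrite (negPf (lrend_neq _ _)).
  by rewrite !no !orbF.
- apply: eq_big => [a|a _]; last exact: eps_stackl.
  rewrite !ffunE !mem_cat -!/(rend _ (_, _)) !(mem_map (@rend_inj _ _)).
  have no b k : (rend (narr D) (a, b) \in [seq lend (narr E) e | e <- strand D k]) = false.
    by apply/mapP => -[e _ /eqP]; rewrite eq_sym (negPf (lrend_neq _ _)).
  by rewrite !no.
Qed.

Lemma wBP_inv_stack D E : wBP_inv (stack D E) = wBP_inv D + wBP_inv E.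
Proof.
congr (_, _); apply/ffunP => i; rewrite !ffunE /=.
  by rewrite /vlk_mod !vlk_stack !rmorphD /= addrACA.
rewrite /vlk_star_mod -rmorphD -big_split; congr _%:~R.
by apply: eq_bigr => k _; rewrite vlk_stack.
Qed.

Lemma wBP_inv_equiv D D' : welded_equiv (wBP_move n) D D' -> wBP_inv D = wBP_inv D'.
Proof.
elim=> {D D'} [D D' [|/wBP_inv_welded|/wBP_inv_wBP]|D|D D' _|D D' E _ -> _ ->] //.
exact: wBP_inv_iso.
Qed.

End Invariance.

(** * Generators and relations *)

Section Structure.
Variable n : nat.
Notation letter := ('I_n * (nat * bool))%type.
Notation word := (seq letter).
Notation wsl := (wSL (wBP_move n)).
Implicit Types (L : word) (i j k : 'I_n).

(** A name of its own for the product, on which the structure of commutative monoid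
    needed for iterated products is declared. *)
Definition wmul (x y : wsl) : wsl := (x * y)%g.

Lemma ucls_nil : ucls [::] = 1%g :> wsl.
Proof.
apply: (cls_realizes (D := empty_gauss n) (f := @nat_of_ord 0)); split.
- exact: val_inj.
- by move=> a; rewrite ffunE.
- by move=> i; rewrite ffunE.
Qed.

Lemma ucls_cat L1 L2 : valid L1 -> valid L2 ->
  {in labels L1, forall a, a \notin labels L2} -> ucls (L1 ++ L2) = wmul (ucls L1) (ucls L2).
Proof.
rewrite /ucls => v1 v2 dis; have [D1 [f1 [r1 ->]]] := clsP (fun=> true) v1.
have [D2 [f2 [r2 ->]]] := clsP (fun=> true) v2.
rewrite [RHS](wSL_mul_pi (wBP_move n)); have [f1_inj s1 e1] := r1; have [f2_inj s2 e2] := r2.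
have f12 a1 a2 : f1 a1 <> f2 a2.
  move=> e; have := dis (f1 a1) (mem_labels (realizes_mem a1 true r1)).
  by rewrite e (mem_labels (realizes_mem a2 true r2)).
pose f (a : arrow (stack D1 D2)) := match split a with inl b => f1 b | inr b => f2 b end.
have fl b : f (lshift _ b) = f1 b by rewrite /f (unsplitK (inl _ b)).
have fr b : f (rshift _ b) = f2 b by rewrite /f (unsplitK (inr _ b)).
apply: (cls_realizes (f := f)); split=> [a b|a|i].
- case: (split_ordP a) => a' ->; case: (split_ordP b) => b' ->; rewrite ?fl ?fr.
  + by move/f1_inj->.
  + by move/f12.
  + by move/esym/f12.
  + by move/f2_inj->.
- by case: (split_ordP a) => b ->; rewrite ?sgn_stackr ?sgn_stackl ?s1 ?s2.
- rewrite ffunE on_strand_cat -e1 -e2 map_cat -!map_comp.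
  by congr (_ ++ _); apply: eq_map => e /=; rewrite ?fl ?fr.
Qed.

(** Names may be taken as large as required, which makes words disjoint. *)
Lemma wsl_word N (x : wsl) : exists L, [/\ valid L, {in labels L, forall a, N <= a} & x = ucls L].
Proof.
elim/quotW: x => D; have [s [L r]] := has_word D; have vL := realizes_valid r.
have inj : {in labels L &, injective (addn N)} by move=> a b _ _ /addnI.
exists (rename (addn N) L); split.
- case/andP: vL => uL bL; rewrite /valid ends_relabel /balanced map_inj_uniq ?uL.
    by apply/allP => _ /mapP[e /(allP bL) eL ->]; apply/mapP; exists (e.1, ~~ e.2).
  by move=> [a b] [c d] [/addnI-> ->].
- by move=> a; rewrite labels_ends ends_relabel -map_comp => /mapP[e _ ->]; apply: leq_addr.
- rewrite -(cls_realizes r) (cls_sign _ (fun=> true) vL).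
  exact: cls_rename.
Qed.

(** Concatenation in either order gives permuted words. *)
Lemma wmulC : commutative wmul.
Proof.
move=> x y; have [L [vL _ ->]] := wsl_word 0 x.
have [L' [vL' L'N ->]] := wsl_word (\max_(a <- labels L) a).+1 y.
have dis : {in labels L, forall a, a \notin labels L'}.
  by move=> a aL; apply/negP => /L'N; rewrite ltnNge leq_bigmax_seq.
have dis' : {in labels L', forall a, a \notin labels L}.
  by move=> a aL'; apply: contraL aL' => /dis.
rewrite -!ucls_cat //; apply: ucls_perm; last by rewrite perm_catC.
apply: (valid_insert (w := ends L) vL'); first exact: vL.
  by case=> a b /mem_labels/dis.
by rewrite /ends map_cat.
Qed.

Lemma wmulA : associative wmul.
Proof. exact: mulgA. Qed.

Lemma wmul1 : left_id (1%g : wsl) wmul.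
Proof. exact: mul1g. Qed.

HB.instance Definition _ := Monoid.isComLaw.Build wsl 1%g wmul wmulA wmulC wmul1.

Definition arrow_word a i j : word := [:: (i, (a, tail)); (j, (a, head))].

Definition arr i j : wsl := ucls (arrow_word 0 i j).

Lemma valid_arrow a i j L : valid L -> a \notin labels L -> valid (arrow_word a i j ++ L).
Proof.
move=> vL aL; apply: (valid_insert (w := [:: (a, tail); (a, head)]) vL) => //.
  by rewrite /balanced /= !inE !xpair_eqE !eqxx.
by move=> e; rewrite !inE => /orP[] /eqP->.
Qed.

Lemma ucls_arrow a i j L : valid L -> a \notin labels L ->
  ucls (arrow_word a i j ++ L) = wmul (arr i j) (ucls L).
Proof.
move=> vL aL; have va b : valid (arrow_word b i j).
  by rewrite -[arrow_word _ _ _]cats0; apply: valid_arrow.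
rewrite ucls_cat //; last by move=> b; rewrite !inE => /orP[] /eqP->.
congr wmul; apply/esym.
have -> : arrow_word a i j = rename (fun=> a) (arrow_word 0 i j) by [].
by apply: cls_rename => // x y; rewrite !inE => /orP[] /eqP-> /orP[] /eqP->.
Qed.

Lemma arr_self i : arr i i = 1%g.
Proof.
rewrite /arr -ucls_nil (@ucls_R1 n _ 0 true) //.
by exists i; rewrite /= !eqxx.
Qed.

Lemma arr_sq i j : wmul (arr i j) (arr i j) = 1%g.
Proof.
pose L := arrow_word 0 i j ++ arrow_word 1 i j ++ [::].
have v1 : valid (arrow_word 1 i j ++ [::]) by apply: valid_arrow.
have vL : valid L by apply: valid_arrow.
have <- : ucls L = wmul (arr i j) (arr i j).
  by rewrite !ucls_arrow // ucls_nil /wmul mulg1.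
rewrite (@ucls_perm _ _ [:: (i, (0, tail)); (i, (1, tail)); (j, (0, head)); (j, (1, head))]) //.
  rewrite (@ucls_R2 n _ 0 1 true true) //.
  - exact: ucls_nil.
  - by exists i; apply: prefix_infix; rewrite /= !eqxx.
  - by exists j; apply: (@infix_catl _ [:: _; _] _ [:: _; _]); apply: infix_refl.
by apply/seq.permP => P /=; lia.
Qed.

(** The relation is given by a band-pass with portions on the strands i, j, k and i. *)
Lemma arr_triangle i j k :
  wmul (arr i k) (wmul (arr j k) (arr j i)) = wmul (arr k i) (wmul (arr k j) (arr i j)).
Proof.
pose L i1 j1 i2 j2 i3 j3 i4 j4 : word := arrow_word 1 i1 j1 ++ arrow_word 2 i2 j2 ++
  arrow_word 3 i3 j3 ++ arrow_word 4 i4 j4 ++ [::].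
have vL i1 j1 i2 j2 i3 j3 i4 j4 : valid (L i1 j1 i2 j2 i3 j3 i4 j4) by do 4!(apply: valid_arrow; last by []).
have uL i1 j1 i2 j2 i3 j3 i4 j4 : ucls (L i1 j1 i2 j2 i3 j3 i4 j4) =
    wmul (arr i1 j1) (wmul (arr i2 j2) (wmul (arr i3 j3) (arr i4 j4))).
  rewrite /L; do ![rewrite ucls_arrow; [|by do ?(apply: valid_arrow; last by [])|by []]].
  by rewrite ucls_nil /wmul mulg1.
have := uL i k i i j k j i; have := uL k i i i k j i j.
rewrite !arr_self /wmul !mul1g => <- <-.
(* A band-pass configuration with two of its four portions on strand i, so that
   arrow 2 contributes arr i i, which is trivial. *)
pose W : word := [:: (i, (1, tail)); (i, (2, tail)); (j, (3, tail)); (j, (4, tail));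
  (k, (1, head)); (k, (3, head)); (i, (2, head)); (i, (4, head))].
have vW : valid W by [].
have pW : perm_eq W (L i k i i j k j i) by apply/seq.permP => P /=; lia.
pose W' : word := [:: (i, (1, head)); (i, (2, head)); (j, (3, head)); (j, (4, head));
  (k, (1, tail)); (k, (3, tail)); (i, (2, tail)); (i, (4, tail))].
have revW : relabel (rev_in [:: 1; 2; 3; 4]) W = W' by [].
have pW' : perm_eq W' (L k i i i k j i j) by apply/seq.permP => P /=; lia.
rewrite -(ucls_perm vW pW) (@ucls_BP n W 1 2 3 4 true true true true) //.
- by rewrite revW; apply: ucls_perm.
- by exists i; apply: prefix_infix; rewrite /= !eqxx.
- by exists j; apply: (@infix_catl _ [:: _; _] _ [:: _; _]); apply: prefix_infix; rewrite /= !eqxx.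
- by exists k; apply: (@infix_catl _ [:: _; _] _ [:: _; _; _; _]); apply: prefix_infix; rewrite /= !eqxx.
- by exists i; apply: (@infix_catl _ [:: _; _] _ [:: _; _; _; _; _; _]); apply: prefix_infix; rewrite /= !eqxx.
Qed.

Lemma ends_inj L : uniq (ends L) -> {in L &, injective (@snd 'I_n (nat * bool))}.
Proof.
move=> u x y xL yL e; rewrite -(nth_index x xL) -(nth_index x yL); congr nth.
by apply/eqP; rewrite -(nth_uniq x.2 _ _ u) ?size_map ?index_mem // !(nth_map x) ?index_mem // !nth_index // e.
Qed.

(** A word can be permuted so that it begins with the two endpoints of one of its
    arrows. *)
Lemma wsl_ind (P : wsl -> Prop) : P 1%g -> (forall i j x, P x -> P (wmul (arr i j) x)) ->
  forall x, P x.
Proof.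
move=> P1 Parr x; have [L [vL _ ->]] := wsl_word 0 x.
have [m] := ubnP (size L); elim: m L vL => // m IH [|[i0 [a b]] L'].
  by rewrite ucls_nil.
set L := _ :: L' => vL Lm; have aL : a \in labels L by rewrite inE eqxx.
clearbody L.
have /mem_ends[i at_i] := valid_ends tail vL aL.
have /mem_ends[j ah_j] := valid_ends head vL aL.
have uL : uniq L by case/andP: vL => /map_uniq.
have pL : perm_eq L (arrow_word a i j ++ del [:: a] L).
  apply: uniq_perm => //.
    rewrite cat_uniq filter_uniq // andbT [uniq _]/= inE !xpair_eqE !andbF andTb.
    by apply/hasPn => y; rewrite mem_filter !inE => /andP[ya _];
      apply: contra ya => /orP[] /eqP->.
  have inj := ends_inj (proj1 (andP vL)).
  move=> [k [c d]]; rewrite mem_cat mem_filter !inE /= !xpair_eqE.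
  have [->|ca] := eqVneq c a; last by rewrite !andbF.
  rewrite andFb orbF; apply/idP/orP => [kL|[] /and3P[/eqP-> _ /eqP->] //].
  by case: d kL => kL; [right; case: (inj _ _ kL ah_j erefl) => -> |
    left; case: (inj _ _ kL at_i erefl) => ->]; rewrite !eqxx.
rewrite (ucls_perm vL pL) ucls_arrow; first last.
- by rewrite labels_del mem_filter inE eqxx.
- exact: valid_del.
apply: Parr; apply: IH; first exact: valid_del.
by move: Lm; rewrite (perm_size pL) size_cat /=; lia.
Qed.

End Structure.

(** * Classification *)

Section Classification.
Variables (n : nat) (n_gt0 : 0 < n).
Notation wsl := (wSL (wBP_move n)).
Notation values := (wBP_values n).
Implicit Types (i j k : 'I_n) (x y : wsl).
Local Open Scope ring_scope.

Definition wsl_inv x : values := wBP_inv (generic_quotient.repr x).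

Lemma wsl_inv_pi (D : gauss n) : wsl_inv (\pi_wsl D)%qT = wBP_inv D.
Proof. by apply/wBP_inv_equiv/wSL_eqP; rewrite reprK. Qed.

Lemma wsl_invM x y : wsl_inv (wmul x y) = wsl_inv x + wsl_inv y.
Proof.
elim/quotW: x => D; elim/quotW: y => E.
by rewrite [wmul _ _](wSL_mul_pi (wBP_move n)) !wsl_inv_pi wBP_inv_stack.
Qed.

Lemma wsl_inv1 : wsl_inv 1%g = 0.
Proof.
by apply: (addIr (wsl_inv 1%g)); rewrite -wsl_invM wmul1 add0r.
Qed.

Definition e_pair (p : strand_pair n) : {ffun strand_pair n -> 'Z_2} := [ffun q => (q == p)%:R].

Definition e_star i : {ffun 'I_n.-1 -> 'Z_2} :=
  [ffun k => (widen_ord (leq_pred n) k == i)%:R].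

(** The two directions of an arrow are distinguished by the strand that it leaves. *)
Lemma wsl_inv_arr (p : strand_pair n) :
  wsl_inv (arr (val p).1 (val p).2) = (e_pair p, e_star (val p).1) /\
  wsl_inv (arr (val p).2 (val p).1) = (e_pair p, e_star (val p).2).
Proof.
have inv_arr i j : i != j -> wsl_inv (arr i j) =
    ([ffun q : strand_pair n => ((val q == (i, j)) || (val q == (j, i)))%:R], e_star i).
  move=> ij; have v : valid (arrow_word 0 i j) by [].
  have [D [f [r e]]] := clsP (fun=> true) v; rewrite [arr i j]e wsl_inv_pi.
  have [f_inj _ fL] := r.
  have f0 a : f a = 0%N.
    by have := mem_labels (realizes_mem a true r); rewrite !inE orbb => /eqP.
  have [a0 _] : exists a, f a = 0%N by apply: (realizes_surj r); rewrite inE eqxx.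
  have memE a b k : ((a, b) \in strand D k) = (k == if b then j else i).
    rewrite -(mem_map (end_map_inj f_inj) _ (a, b)) fL mem_on_strand f0 !inE !xpair_eqE /=.
    by case: b; rewrite ?andbF ?andbT ?orbF.
  have sum1 (F : arrow D -> 'Z_2) : \sum_a F a = F a0.
    rewrite (bigD1 a0) //= big_pred0 ?addr0 // => a; apply/negbTE; rewrite negbK.
    by apply/eqP/f_inj; rewrite !f0.
  congr (_, _); apply/ffunP; [move=> q | move=> k]; rewrite !ffunE.
    rewrite !vlk_modE !sum1 !memE; case: q => -[u v'] /= uv; rewrite !xpair_eqE.
    have [->|_] := eqVneq u i; first by rewrite (negPf ij) andbF orbF addr0.
    by rewrite add0r andbC.
  rewrite vlk_star_modE sum1 !memE /=; case: eqP => // ->.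
  by rewrite (negPf ij).
case: p => -[i j] /= ij; have nij : i != j by apply: contraTneq ij => ->; rewrite ltnn.
have pE (q : strand_pair n) : (val q == (i, j)) || (val q == (j, i)) = (val q == (i, j)).
  apply/orb_idr => /eqP qE; case: q qE => q /= lt qE.
  by move: lt; rewrite qE /= ltnNge ltnW.
rewrite !inv_arr //; last by rewrite eq_sym.
by split; congr (_, _); apply/ffunP => q; rewrite !ffunE 1?[(val q == (j, i)) || _]orbC pE -val_eqE.
Qed.

Fact last_strand_subproof : (n.-1 < n)%N.
Proof. by rewrite prednK. Qed.

Definition last_strand : 'I_n := Ordinal last_strand_subproof.
Notation l := last_strand.

(** Its value has a single nonzero component, at strand i; for the last strand, which
    has no component, this class is trivial. *)
Definition star_gen i : wsl := wmul (arr i l) (arr l i).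

(** The factor [star_gen] cancels the parity of the strand that the arrow leaves. *)
Definition pair_gen (p : strand_pair n) : wsl :=
  wmul (arr (val p).1 (val p).2) (star_gen (val p).1).

Lemma wmulACA : interchange (@wmul n) (@wmul n).
Proof. exact: Monoid.mulmACA. Qed.

Lemma wmulx1 x : wmul x 1%g = x.
Proof. exact: mulg1. Qed.

Lemma wmul_sq x : wmul x x = 1%g.
Proof.
elim/wsl_ind: x => [|i j x IH]; first by rewrite wmul1.
by rewrite wmulACA arr_sq IH wmul1.
Qed.

(** The power of an involution x with exponent modulo 2. *)
Definition pw x (c : 'Z_2) : wsl := if c == 0 then 1%g else x.

Lemma pwD x c d : pw x (c + d) = wmul (pw x c) (pw x d).
Proof.
case: c d => -[|[|//]] c1 [[|[|//]] d1]; rewrite /pw -!val_eqE /= ?wmul1 ?wmulx1 //.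
by rewrite wmul_sq.
Qed.

Definition word_of (v : values) : wsl :=
  wmul (\big[@wmul n/1%g]_p pw (pair_gen p) (v.1 p))
       (\big[@wmul n/1%g]_k pw (star_gen (widen_ord (leq_pred n) k)) (v.2 k)).

Lemma word_ofD u v : word_of (u + v) = wmul (word_of u) (word_of v).
Proof.
rewrite /word_of wmulACA -!big_split /=.
by congr wmul; apply: eq_bigr => k _; rewrite ffunE pwD.
Qed.

Lemma star_gen_last : star_gen l = 1%g.
Proof. by rewrite /star_gen arr_self wmul1. Qed.

(** This includes the case of the last strand, where [e_star i] and [star_gen i] are
    both trivial. *)
Lemma word_of_e p i : word_of (e_pair p, e_star i) = wmul (pair_gen p) (star_gen i).
Proof.
congr wmul.
  rewrite (bigD1 p) //= ffunE eqxx big1 ?wmulx1 //= => q /negPf qp.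
  by rewrite ffunE qp.
have [il|il] := eqVneq i l.
  rewrite il star_gen_last big1 // => k _; rewrite ffunE -val_eqE /= ltn_eqF //.
have ltin : (i < n.-1)%N.
  by move: il; rewrite -val_eqE /= ltn_neqAle => ->; rewrite -ltnS prednK ?ltn_ord.
rewrite (bigD1 (Ordinal ltin)) //= ffunE.
have -> : widen_ord (leq_pred n) (Ordinal ltin) = i by apply: val_inj.
rewrite eqxx big1 ?wmulx1 //= => k /negPf ki; rewrite ffunE -val_eqE /=.
by rewrite -val_eqE /= in ki; rewrite ki.
Qed.

(** It is enough to check generators.  The class [arr i j] with j < i is obtained from
    those with i < j by the triangle relation for i, j and the last strand. *)
Lemma wsl_invK : cancel wsl_inv word_of.
Proof.
have word0 : word_of 0 = 1%g.
  by rewrite /word_of !big1 ?wmul1 // => k _; rewrite ffunE.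
elim/wsl_ind => [|i j x IH]; first by rewrite wsl_inv1.
rewrite wsl_invM word_ofD IH; congr wmul.
have [ij|ji|ij] := ltngtP i j.
- pose p : strand_pair n := Sub (i, j) ij.
  have [-> _] := wsl_inv_arr p; rewrite word_of_e /pair_gen /= -wmulA.
  by rewrite wmul_sq wmulx1.
- pose p : strand_pair n := Sub (j, i) ji.
  have [_ ->] := wsl_inv_arr p; rewrite word_of_e /pair_gen /= /star_gen.
  have tri := arr_triangle i j l.
  have -> : wmul (wmul (arr j i) (wmul (arr j l) (arr l j))) (wmul (arr i l) (arr l i)) =
    wmul (wmul (arr i l) (wmul (arr j l) (arr j i))) (wmul (arr l i) (arr l j)).
    by rewrite [LHS](AC (1*2*2) ((4*2*1)*(5*3))) /= !wmulA.
  by rewrite tri (wmulA (arr l i)) [LHS]wmulC wmulA wmul_sq wmul1.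
- have -> : i = j by apply: val_inj.
  by rewrite arr_self wsl_inv1 word0.
Qed.

Lemma wsl_inv_big (I : finType) (F : I -> wsl) (c : I -> 'Z_2) :
  wsl_inv (\big[@wmul n/1%g]_i pw (F i) (c i)) = \sum_i (if c i == 0 then 0 else wsl_inv (F i)).
Proof.
rewrite (big_morph wsl_inv wsl_invM wsl_inv1); apply: eq_bigr => i _.
by rewrite /pw; case: ifP; rewrite ?wsl_inv1.
Qed.

Lemma wsl_inv_star i : (i < n.-1)%N -> wsl_inv (star_gen i) = (0, e_star i).
Proof.
move=> il; pose p : strand_pair n := Sub (i, l) il; have [e1 e2] := wsl_inv_arr p.
rewrite wsl_invM e1 e2 /=; congr (_, _); apply/ffunP => q; rewrite !ffunE ?addbb2 //.
have -> : (widen_ord (leq_pred n) q == l) = false by rewrite -val_eqE /= ltn_eqF.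
by rewrite addr0.
Qed.

Lemma wsl_inv_pair p : wsl_inv (pair_gen p) = (e_pair p, 0).
Proof.
rewrite wsl_invM (proj1 (wsl_inv_arr p)) wsl_inv_star; last first.
  by rewrite (leq_trans (valP p)) // -ltnS prednK.
by congr (_, _); apply/ffunP => q; rewrite !ffunE ?addr0 ?addbb2.
Qed.

Lemma Z2_indicator (c : 'Z_2) : (if c == 0 then 0 else 1) = c.
Proof. by case: c => -[|[|//]] c1; apply: val_inj. Qed.

(** The generators have the elements of the standard basis as values. *)
Lemma word_ofK : cancel word_of wsl_inv.
Proof.
case=> u w; rewrite wsl_invM !wsl_inv_big.
have fst_sum (I : finType) (F : I -> values) : (\sum_i F i).1 = \sum_i (F i).1.
  exact: (big_morph fst (fun _ _ => erefl) erefl).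
have snd_sum (I : finType) (F : I -> values) : (\sum_i F i).2 = \sum_i (F i).2.
  exact: (big_morph snd (fun _ _ => erefl) erefl).
rewrite [LHS]surjective_pairing; congr (_, _).
- rewrite -[LHS]/((\sum_p _ : values).1 + (\sum_k _ : values).1) !fst_sum [X in _ + X]big1 => [|k _]; last first.
    by case: eqP => // _; rewrite wsl_inv_star //=; apply: ltn_ord.
  rewrite addr0; apply/ffunP => q; rewrite sum_ffunE (bigD1 q) //= big1 => [|p pq].
    rewrite addr0 -[RHS]Z2_indicator; case: eqP => _; first by rewrite ffunE.
    by rewrite wsl_inv_pair /= ffunE eqxx.
  case: eqP => _; first by rewrite ffunE.
  by rewrite wsl_inv_pair /= ffunE eq_sym (negPf pq).
- rewrite -[LHS]/((\sum_p _ : values).2 + (\sum_k _ : values).2) !snd_sum [X in X + _]big1 => [|p _]; last first.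
    by case: eqP => // _; rewrite wsl_inv_pair.
  rewrite add0r; apply/ffunP => q; rewrite sum_ffunE (bigD1 q) //= big1 => [|k kq].
    rewrite addr0 -[RHS]Z2_indicator; case: eqP => _; first by rewrite ffunE.
    by rewrite wsl_inv_star /= ?ltn_ord // ffunE eqxx.
  case: eqP => _; first by rewrite ffunE.
  rewrite wsl_inv_star /= ?ltn_ord // ffunE -val_eqE /=.
  by rewrite (negPf (_ : val q != val k)) // eq_sym.
Qed.

End Classification.

Lemma card_strand_pair n : #|{: strand_pair n}| = 'C(n, 2).
Proof.
rewrite card_sig -sum1_card.
have -> : \sum_(p in [pred p : 'I_n * 'I_n | p.1 < p.2]) 1 = \sum_(j < n) \sum_(i < n | i < j) 1.
  by rewrite (exchange_big_dep xpredT) //= pair_big_dep.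
rewrite -bin2_sum big_mkord; apply: eq_bigr => j _.
by rewrite -(big_ord_widen n (fun=> 1)) 1?ltnW // sum1_card card_ord.
Qed.

Theorem proposition3p9 (n : nat) (hn : (1 <= n)%N) :
  [/\ #|{: strand_pair n}| = (n * (n - 1)) %/ 2
      /\ #|{: strand_pair n + 'I_n.-1}| = ((n + 2) * (n - 1)) %/ 2,
      forall D D' : gauss n, diagram_iso D D' -> wBP_inv D = wBP_inv D',
      forall D D' : gauss n, welded_move D D' -> wBP_inv D = wBP_inv D',
      forall D D' : gauss n, wBP D D' -> wBP_inv D = wBP_inv D'
    & exists phi : wSL (wBP_move n) -> wBP_values n,
        [/\ forall D : gauss n, phi (\pi_(wSL (wBP_move n))%qT D) = wBP_inv D,
            phi 1%g = 0%R,
            forall x y : wSL (wBP_move n), phi (x * y)%g = (phi x + phi y)%R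
          & bijective phi]].
Proof.
split.
- rewrite card_sum card_ord card_strand_pair bin2 -divn2 subn1; split=> //.
  by rewrite mulnDl (mulnC 2) [in RHS]addnC divnMDl // addnC.
- exact: wBP_inv_iso.
- exact: wBP_inv_welded.
- exact: wBP_inv_wBP.
exists (@wsl_inv n); split.
- exact: wsl_inv_pi.
- exact: wsl_inv1.
- exact: wsl_invM.
- by exists (word_of hn); [apply: wsl_invK | apply: word_ofK].
Qed.
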